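(* Let $(M^n,g)$ be a connected smooth Riemannian manifold, $n\ge3$, satisfying the sectional sign trichotomy. If $\delta_{\mathrm{sec}}$ is locally uniformly bounded away from zero, i.e. for every compact $K\subset M$ there is $\delta_K>0$ with $\delta_{\mathrm{sec}}\ge\delta_K$ on the nonflat part of $K$, then exactly one of the following holds: (a) $\operatorname{Rm}\equiv0$; (b) $\mathcal N_{\mathrm{sec}}=\varnothing$, $\mathcal P_{\mathrm{sec}}\ne\varnothing$, and $\mathcal Z_{\mathrm{sec}}$ has empty interior; (c) $\mathcal P_{\mathrm{sec}}=\varnothing$, $\mathcal N_{\mathrm{sec}}\ne\varnothing$, and $\mathcal Z_{\mathrm{sec}}$ has empty interior. More generally, it is enough to impose locally uniform pinching on $\mathcal P_{\mathrm{sec}}$ alone (for every compact $K\subset M$ there is $\delta_K>0$ with $\delta_{\mathrm{sec}}\ge\delta_K$ on $K\cap\mathcal P_{\mathrm{sec}}$): then either $\mathcal P_{\mathrm{sec}}=\varnothing$, or $\mathcal N_{\mathrm{sec}}=\varnothing$ and $\mathcal Z_{\mathrm{sec}}$ has empty interior. The symmetric one-sided statement holds with $\mathcal P_{\mathrm{sec}}$ and $\mathcal N_{\mathrm{sec}}$ interchanged. No completeness, compactness, curvature bound, or regularity of $\partial\mathcal Z_{\mathrm{sec}}$ is assumed.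
   Context: Curvature convention: the unit round sphere has positive sectional curvature; $\operatorname{Rm}$ is the Riemann curvature tensor. $(M,g)$ satisfies the sectional sign trichotomy if at every point $p$ exactly one of the following holds: (i) $K_p(\sigma)>0$ for every $2$-plane $\sigma\subset T_pM$; (ii) $K_p(\sigma)<0$ for every $2$-plane $\sigma\subset T_pM$; (iii) $\operatorname{Rm}_p=0$. The sets of points of type (i), (ii), (iii) are denoted $\mathcal P_{\mathrm{sec}}$, $\mathcal N_{\mathrm{sec}}$, $\mathcal Z_{\mathrm{sec}}$. A point is nonflat if $\operatorname{Rm}_p\ne0$; at a nonflat point the pinching ratio is $$\delta_{\mathrm{sec}}(p)=\frac{\min_{\sigma\subset T_pM}|K_p(\sigma)|}{\max_{\sigma\subset T_pM}|K_p(\sigma)|}\in(0,1].$$ *)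

(* Defs.v *)
From mathcomp Require Import all_boot all_order all_algebra.
From mathcomp Require Import all_classical all_reals all_analysis.

Set Implicit Arguments.
Unset Strict Implicit.
Unset Printing Implicit Defensive.

Import Order.TTheory GRing.Theory Num.Theory.
Import numFieldNormedType.Exports.

Local Open Scope classical_set_scope.
Local Open Scope ring_scope.

Definition exactly_one3 (A B C : Prop) : Prop :=
  [\/ [/\ A, ~ B & ~ C], [/\ ~ A, B & ~ C] | [/\ ~ A, ~ B & C]].

Section Smooth.
Context {R : realType} {n : nat} {W : normedModType R}.
Implicit Types (D : set 'rV[R]_n) (f : 'rV[R]_n -> W).

Definition partial (i : 'I_n) f (x : 'rV[R]_n) : W := 'D_(delta_mx 0 i) f x.

(* Intended for open D: the values of f off D are then irrelevant. *)
Fixpoint Ck (k : nat) D f : Prop :=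
  if k is k'.+1 then
    (forall x, D x -> differentiable f x) /\ (forall i, Ck k' D (partial i f))
  else forall x, D x -> {for x, continuous f}.

Definition smooth_on D f : Prop := forall k, Ck k D f.

End Smooth.

Section Manifold.
Context (R : realType) (n : nat) (M : topologicalType).

Record chart := Chart {
  dom : set M;
  coord :> M -> 'rV[R]_n;
  coord_inv : 'rV[R]_n -> M }.

Definition is_chart (c : chart) : Prop :=
  [/\ open (dom c), open (c @` dom c),
      forall p, dom c p -> coord_inv c (c p) = p,
      forall p, dom c p -> {for p, continuous c} &
      forall x, (c @` dom c) x -> {for x, continuous (coord_inv c)}].

Definition overlap (c d : chart) : set 'rV[R]_n := c @` (dom c `&` dom d).

Definition transition (c d : chart) : 'rV[R]_n -> 'rV[R]_n :=
  coord d \o coord_inv c.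

Record smooth_structure := SmoothStructure {
  atlas : set chart;
  atlas_chart : forall c, atlas c -> is_chart c;
  atlas_cover : forall p, exists2 c, atlas c & dom c p;
  atlas_smooth : forall c d, atlas c -> atlas d ->
    smooth_on (overlap c d) (transition c d) }.

End Manifold.

Section MetricInCoordinates.
Context {R : realType} {n : nat}.
Variable G : 'rV[R]_n -> 'M[R]_n.
Implicit Types (x u v w z : 'rV[R]_n) (i j k l : 'I_n).

Definition inner x u v : R := (u *m G x *m v^T) 0 0.

(* The coefficient Gamma^k_ij of the Levi-Civita connection. *)
Definition christoffel k i j x : R :=
  2^-1 * \sum_l invmx (G x) k l *
    (partial i (fun y => G y j l) x + partial j (fun y => G y i l) x
     - partial l (fun y => G y i j) x).

(* The l-th component of R(d_i, d_j) d_k, with the convention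
   R(X, Y) Z = nabla_X nabla_Y Z - nabla_Y nabla_X Z - nabla_[X, Y] Z. *)
Definition curvature_coef i j k l x : R :=
  partial i (christoffel l j k) x - partial j (christoffel l i k) x
  + \sum_m (christoffel l i m x * christoffel m j k x
            - christoffel l j m x * christoffel m i k x).

Definition curvature x u v w : 'rV[R]_n :=
  \row_l \sum_i \sum_j \sum_k
    u 0 i * v 0 j * w 0 k * curvature_coef i j k l x.

Definition Rm x u v w z : R := inner x (curvature x u v w) z.

(* With the convention above, this is positive on round spheres. *)
Definition sectional x u v : R :=
  Rm x u v v u / (inner x u u * inner x v v - inner x u v ^+ 2).

End MetricInCoordinates.

(* A metric is given by its coefficient matrices in the charts of the atlas.
   Tangent vectors are coordinate rows, so a coordinate change acts on them by
   v |-> v *m 'J, and the last field says that g is a well-defined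
   covariant 2-tensor. *)
Record riemannian_metric (R : realType) (n : nat) (M : topologicalType)
    (S : smooth_structure R n M) := RiemannianMetric {
  metric :> chart R n M -> 'rV[R]_n -> 'M[R]_n;
  metric_smooth : forall c, atlas S c -> smooth_on (c @` dom c) (metric c);
  metric_sym : forall c x, atlas S c -> (c @` dom c) x ->
    (metric c x)^T = metric c x;
  metric_pos : forall c x v, atlas S c -> (c @` dom c) x -> v != 0 ->
    0 < inner (metric c) x v v;
  metric_change : forall c d x, atlas S c -> atlas S d -> overlap c d x ->
    metric c x = jacobian (transition c d) x *m
      metric d (transition c d x) *m (jacobian (transition c d) x)^T }.

Section Curvature.
Context {R : realType} {n : nat} {M : topologicalType}.
Context {S : smooth_structure R n M}.
Variable g : riemannian_metric S.
Implicit Types p : M.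

(* A 2-plane in T_p M, presented by the coordinates of a basis of it in some
   chart around p.  A plane has many presentations (several charts, several
   bases); by tensoriality they all have the same sectional curvature. *)
Record tangent_plane p := TangentPlane {
  plane_chart : chart R n M;
  plane_u : 'rV[R]_n;
  plane_v : 'rV[R]_n;
  plane_atlas : atlas S plane_chart;
  plane_dom : dom plane_chart p;
  plane_free : row_free (col_mx plane_u plane_v) }.

Definition K_sec p (s : tangent_plane p) : R :=
  sectional (g (plane_chart s)) (plane_chart s p) (plane_u s) (plane_v s).

Definition flat_at p : Prop :=
  forall c, atlas S c -> dom c p ->
  forall u v w z, Rm (g c) (c p) u v w z = 0.

Definition pos_at p : Prop := forall s : tangent_plane p, 0 < K_sec s.

Definition neg_at p : Prop := forall s : tangent_plane p, K_sec s < 0.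

Definition P_sec : set M := [set p | pos_at p].
Definition N_sec : set M := [set p | neg_at p].
Definition Z_sec : set M := [set p | flat_at p].
Definition nonflat : set M := [set p | ~ flat_at p].

Definition sectional_trichotomy : Prop :=
  forall p, exactly_one3 (pos_at p) (neg_at p) (flat_at p).

Definition abs_K_values p : set R :=
  range (fun s : tangent_plane p => `|K_sec s|).

(* The 2-planes in T_p M form a compact space on which |K| is continuous, so
   inf and sup are the minimum and the maximum. *)
Definition delta_sec p : R := inf (abs_K_values p) / sup (abs_K_values p).

Definition locally_pinched_on (A : set M) : Prop :=
  forall K : set M, compact K ->
  exists2 dK : R, 0 < dK & forall p, (K `&` A) p -> dK <= delta_sec p.

End Curvature.

(* Main.v *)
From HB Require Import structures.
Require Import Defs.
From mathcomp Require Import all_boot all_order all_algebra.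
From mathcomp Require Import all_classical all_reals all_analysis.
From mathcomp Require Import ring lra.

(** Work in one chart.  Let R_ijkl be the lowered curvature tensor and contract
    it with the Euclidean metric of the chart: Ric_bc = sum_a R_abca,
    S = sum_ab R_abba, T = S I - 2 Ric.  The second Bianchi identity gives
    div T = O(|R|).  Moreover |xi|^6 T(xi, xi) is the sum of the
    R(w_a, w_b, w_b, w_a), where w_a is |xi|^2 times the projection of the a-th
    basis vector onto the complement of xi, so that pinching yields
    T >= c S I and |R| <= C S on the set P of positive points, which in the
    chart is {S > 0}.

    Suppose P is neither empty nor dense.  Near a boundary point of its closure
    take a outside the closure of P, let r be the distance from a to P, put
    f = r^2 + tau - |x - a|^2 with tau small, and consider the compactly
    supported field V = (L f_+)^2 T(a - x), L = ln_+ (S / eta).  Its divergence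
    has mean zero, but is at least 2 L^2 f c r^2 S - C' L; as eta tends to 0 the
    quadratic term wins, which is absurd.  The logarithm makes the error
    produced by the cutoff of S bounded by L, so no regularity of the boundary
    is needed.  The mean is taken over finer and finer grids, where the
    divergence theorem is a telescoping sum.

    Negative curvature is the same argument applied to - R. *)

Set Implicit Arguments.
Unset Strict Implicit.
Unset Printing Implicit Defensive.

Import Order.TTheory GRing.Theory Num.Theory.
Import numFieldNormedType.Exports.

Local Open Scope classical_set_scope.
Local Open Scope ring_scope.

(** * Calculus of C^k functions *)

(** Near the boundary of P the curvature may vanish to any order, so nothing there has a positive
    lower bound: every estimate is relative to S, and pinching makes S comparable with the whole
    tensor. For a unit vector xi, T(xi, xi) is the sum of the curvatures over ordered pairs from an
    orthonormal frame of the complement of xi; on P it is therefore positive once n >= 3, while it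
    is zero for n = 2. The terms without derivatives in the Bianchi identity are products of a
    Christoffel symbol and R, so the divergence of T costs only O(S) on P. Differentiating the
    cutoff L^2 gives 2 L dS / S times a component of T, which is O(S): the factor S cancels and O(L)
    remains. The gain comes from differentiating f_+^2, since a - x is half the gradient of f. The
    last term, f_+^2 L^2 times the divergence of T(a - x), is of size f^2 L^2 S, and f <= tau on P
    because P stays at distance r from a; a small tau absorbs it into half of the gain. With eta = s
    exp(-t), the gain near a fixed point of P grows like t^2 and the loss like t. *)

Lemma near_eq_differentiable (R : realType) (V W : normedModType R)
    (f h : V -> W) (x : V) :
  (\near x, f x = h x) -> differentiable f x -> differentiable h x.
Proof.
move=> fh df.
(* The differential of [f] is the candidate for [h], as the two remainders agree near 0;
   [diff_unique] confirms it below. *)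
have E : h \o shift x = cst (h x) + 'd f x +o_ 0 id.
  apply/eqaddoP => _/posnumP[e].
  have /eqaddoP/(_ e%:num)/(_ (ltac:(by []))) := diff_locally df.
  have fh0 : \forall y \near 0, f (y + x) = h (y + x).
    move: fh; rewrite (near_shift 0) /= => fh.
    by apply: filterS fh => y /=; rewrite subr0.
  move=> fe; near=> y.
  have -> : (h \o shift x - (cst (h x) + 'd f x)) y =
            (f \o shift x - (cst (f x) + 'd f x)) y.
    rewrite !fctE /= (nbhs_singleton fh); congr (_ - _); apply/esym.
    by near: y.
  by near: y.
have dE := diff_unique (diff_continuous df) E.
apply/diff_locallyP; rewrite dE; split => //.
exact: diff_continuous.
Unshelve. all: by end_near. Qed.

Section Partial.
Context {R : realType} {n : nat}.
Implicit Types (D : set 'rV[R]_n) (f h : 'rV[R]_n -> R) (x : 'rV[R]_n).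

Lemma near_eq_partial (W : normedModType R) (i : 'I_n) (f h : 'rV[R]_n -> W) x :
  (\near x, f x = h x) -> partial i f x = partial i h x.
Proof. exact: near_eq_derive. Qed.

Lemma partial_cst (i : 'I_n) (a : R) x : partial i (fun=> a) x = 0.
Proof. exact: derive_cst. Qed.

Lemma partialD (i : 'I_n) f h x : differentiable f x -> differentiable h x ->
  partial i (fun y => f y + h y) x = partial i f x + partial i h x.
Proof. by move=> df dh; apply: deriveD; exact: diff_derivable. Qed.

Lemma partialN (i : 'I_n) f x : differentiable f x ->
  partial i (fun y => - f y) x = - partial i f x.
Proof. by move=> df; apply: deriveN; exact: diff_derivable. Qed.

Lemma partialB (i : 'I_n) f h x : differentiable f x -> differentiable h x ->
  partial i (fun y => f y - h y) x = partial i f x - partial i h x.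
Proof. by move=> df dh; apply: deriveB; exact: diff_derivable. Qed.

Lemma partialM (i : 'I_n) f h x : differentiable f x -> differentiable h x ->
  partial i (fun y => f y * h y) x = partial i f x * h x + f x * partial i h x.
Proof.
move=> df dh.
rewrite /partial [LHS](@deriveM _ _ f h); try exact: diff_derivable.
by rewrite addrC mulrC.
Qed.

Lemma partialZ (i : 'I_n) (a : R) f x : differentiable f x ->
  partial i (fun y => a * f y) x = a * partial i f x.
Proof.
move=> df; rewrite (partialM i (differentiable_cst a x) df).
by rewrite (partial_cst i a x) mul0r add0r.
Qed.

Lemma partial_sum (i : 'I_n) m (F : 'I_m -> 'rV[R]_n -> R) x :
  (forall l, differentiable (F l) x) ->
  partial i (fun y => \sum_l F l y) x = \sum_l partial i (F l) x.
Proof.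
move=> dF; rewrite /partial -derive_sum; last by move=> l; exact: diff_derivable.
by congr ('D_ _ _ _); apply/funext => y; rewrite fct_sumE.
Qed.

Lemma differentiable_sumf m (F : 'I_m -> 'rV[R]_n -> R) x :
  (forall l, differentiable (F l) x) ->
  differentiable (fun y => \sum_l F l y) x.
Proof.
move=> dF; have -> : (fun y => \sum_l F l y) = \sum_l F l.
  by apply/funext => y; rewrite fct_sumE.
exact: differentiable_sum.
Qed.

Lemma partial_comp (i : 'I_n) (f : 'rV[R]_n -> R) (h : R -> R) x :
  differentiable f x -> derivable h (f x) 1 ->
  partial i (h \o f) x = h^`()%classic (f x) * partial i f x.
Proof.
move=> df dh; have dh' : differentiable h (f x) by apply/derivable1_diffP.
rewrite /partial !deriveE //; last exact: differentiable_comp.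
rewrite diff_comp //= derive1E' //.
by rewrite -[X in 'd _ _ X = _]mulr1 [LHS]linearZ mulrC.
Qed.

End Partial.

Section CkTheory.
Context {R : realType} {n : nat} {D : set 'rV[R]_n}.
Hypothesis oD : open D.

(** Since [D] is open, equality on [D] is equality near each of its points and passes to all
    derivatives. The closure rules below use this to replace a derivative by its formula. *)
Lemma Ck_ext (W : normedModType R) k (f h : 'rV[R]_n -> W) :
  (forall x, D x -> f x = h x) -> Ck k D f -> Ck k D h.
Proof.
have nf (u w : 'rV[R]_n -> W) x : (forall x, D x -> u x = w x) -> D x ->
    \forall y \near nbhs x, u y = w y.
  by move=> uw Dx; apply: filterS (open_nbhs_nbhs (conj oD Dx)) => y /uw.
elim: k f h => [|k IH] f h fh /=.
  move=> cf x Dx; rewrite /prop_for /continuous_at -(fh x Dx).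
  apply: cvg_trans (cf x Dx); apply: (@near_eq_cvg _ _ (nbhs x)).
  exact: nf fh Dx.
move=> [df pf]; split=> [x Dx|i].
  by apply: near_eq_differentiable (nf _ _ _ fh Dx) (df x Dx).
by apply: IH (pf i) => x Dx; apply: near_eq_partial; exact: nf fh Dx.
Qed.

Lemma CkW (W : normedModType R) k (f : 'rV[R]_n -> W) :
  Ck k.+1 D f -> Ck k D f.
Proof.
elim: k f => [|k IH] f [df pf].
  by move=> x Dx; exact/differentiable_continuous/df.
by split=> // i; apply: IH; exact: pf.
Qed.

Lemma Ck_cst k (a : R) : Ck k D (fun=> a).
Proof.
elim: k a => [|k IH] a /=; first by move=> x _; apply: (@cst_continuous _ _ a).
split=> [x _|i]; first exact: differentiable_cst.
by apply: Ck_ext (IH 0) => x _; rewrite partial_cst.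
Qed.

Lemma CkD k (f h : 'rV[R]_n -> R) :
  Ck k D f -> Ck k D h -> Ck k D (fun y => f y + h y).
Proof.
elim: k f h => [|k IH] f h /=.
  by move=> cf ch x Dx; apply: continuousD; [exact: cf | exact: ch].
move=> [df pf] [dh ph]; split=> [x Dx|i].
  by apply: differentiableD; [exact: df | exact: dh].
apply: Ck_ext (IH _ _ (pf i) (ph i)) => x Dx.
by rewrite partialD //; [exact: df | exact: dh].
Qed.

Lemma CkM k (f h : 'rV[R]_n -> R) :
  Ck k D f -> Ck k D h -> Ck k D (fun y => f y * h y).
Proof.
elim: k f h => [|k IH] f h.
  by move=> cf ch x Dx; apply: continuousM; [exact: cf | exact: ch].
move=> Cf Ch; have [[df pf] [dh ph]] := (Cf, Ch); split=> [x Dx|i].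
  by apply: differentiableM; [exact: df | exact: dh].
apply: Ck_ext (CkD (IH _ _ (pf i) (CkW Ch)) (IH _ _ (CkW Cf) (ph i))) => x Dx.
by rewrite partialM //; [exact: df | exact: dh].
Qed.

Lemma CkZ k (a : R) (f : 'rV[R]_n -> R) : Ck k D f -> Ck k D (fun y => a * f y).
Proof. by apply: CkM; exact: Ck_cst. Qed.

Lemma CkB k (f h : 'rV[R]_n -> R) :
  Ck k D f -> Ck k D h -> Ck k D (fun y => f y - h y).
Proof.
move=> Cf Ch; apply: (Ck_ext _ (CkD Cf (CkZ (-1) Ch))) => x _.
by rewrite mulN1r.
Qed.

(** The derivative - f' / f^2 contains 1/f only undifferentiated, so the induction on [k] closes. *)
Lemma CkV k (f : 'rV[R]_n -> R) : (forall x, D x -> f x != 0) ->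
  Ck k D f -> Ck k D (fun y => (f y)^-1).
Proof.
move=> f0; elim: k => [|k IH].
  by move=> cf x Dx; apply: continuousV; [exact: f0 | exact: cf].
move=> Cf; have [df pf] := Cf; split=> [x Dx|i].
  by apply: differentiableV; [exact: df | exact: f0].
have CV := IH (CkW Cf).
apply: (Ck_ext _ (CkZ (-1) (CkM (CkM CV CV) (pf i)))) => x Dx.
rewrite /partial [RHS](@deriveV _ _ f); [|exact: f0|exact/diff_derivable/df].
by rewrite mulN1r -exprVn expr2 /GRing.scale /= mulNr.
Qed.

Lemma Ck_big_sum k (I : Type) (r : seq I) (P : pred I) (F : I -> 'rV[R]_n -> R) :
  (forall l, Ck k D (F l)) -> Ck k D (fun y => \sum_(l <- r | P l) F l y).
Proof.
move=> CF; elim: r => [|l r IH].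
  by apply: Ck_ext (Ck_cst k 0) => x _; rewrite big_nil.
case Pl: (P l).
  by apply: Ck_ext (CkD (CF l) IH) => x _; rewrite big_cons Pl.
by apply: Ck_ext IH => x _; rewrite big_cons Pl.
Qed.

Lemma Ck_big_prod k (I : Type) (r : seq I) (P : pred I) (F : I -> 'rV[R]_n -> R) :
  (forall l, Ck k D (F l)) -> Ck k D (fun y => \prod_(l <- r | P l) F l y).
Proof.
move=> CF; elim: r => [|l r IH].
  by apply: Ck_ext (Ck_cst k 1) => x _; rewrite big_nil.
case Pl: (P l).
  by apply: Ck_ext (CkM (CF l) IH) => x _; rewrite big_cons Pl.
by apply: Ck_ext IH => x _; rewrite big_cons Pl.
Qed.

Lemma Ck_det k m (F : 'rV[R]_n -> 'M[R]_m) :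
  (forall a b, Ck k D (fun y => F y a b)) -> Ck k D (fun y => \det (F y)).
Proof.
by move=> CF; apply: Ck_big_sum => s; apply: CkZ; apply: Ck_big_prod => a.
Qed.

(** Cramer's rule: an entry of the inverse is a cofactor over the determinant, both polynomial in
    the entries of [F]. *)
Lemma Ck_invmx k m (F : 'rV[R]_n -> 'M[R]_m) a b :
  (forall x, D x -> F x \in unitmx) ->
  (forall a b, Ck k D (fun y => F y a b)) -> Ck k D (fun y => invmx (F y) a b).
Proof.
move=> uF CF.
apply: (@Ck_ext _ k (fun y => (\det (F y))^-1 * cofactor (F y) b a)).
  by move=> x Dx; rewrite /invmx uF // !mxE.
apply: CkM.
  apply: CkV; last exact: Ck_det.
  by move=> x Dx; have := uF x Dx; rewrite unitmxE unitfE.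
apply: CkZ; apply: Ck_det => a' b'.
by apply: Ck_ext (CF (lift b a') (lift a b')) => x Dx; rewrite !mxE.
Qed.

Lemma differentiable_entry (p q : nat) (F : 'rV[R]_n -> 'M[R]_(p, q)) x a b :
  differentiable F x -> differentiable (fun y => F y a b) x.
Proof.
move=> dF; apply: (@differentiable_comp _ _ _ _ F (fun N : 'M[R]_(p, q) => N a b)) => //.
exact: differentiable_coord.
Qed.

Lemma Ck_entry k (p q : nat) (F : 'rV[R]_n -> 'M[R]_(p, q)) a b :
  Ck k D F -> Ck k D (fun y => F y a b).
Proof.
elim: k F => [|k IH] F.
  move=> cF x Dx.
  exact: (continuous_comp (cF x Dx) (@coord_continuous _ _ _ a b (F x))).
move=> [dF pF]; split=> [x Dx|i]; first exact: differentiable_entry (dF x Dx).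
apply: Ck_ext (IH _ (pF i)) => x Dx.
by rewrite /partial derive_mx ?mxE //; exact/diff_derivable/dF.
Qed.

End CkTheory.

(** * Mean values along segments and metric forms of continuity *)

Lemma is_derive_line (R : realType) (V : normedModType R) (f : V -> R)
    (y v : V) (t : R) : derivable f (y + t *: v) v ->
  is_derive t 1 (fun s => f (y + s *: v)) ('D_v f (y + t *: v)).
Proof.
have E : (fun h : R => h^-1 *: (f (y + (h *: 1 + t) *: v) - f (y + t *: v)))
       = (fun h : R => h^-1 *: (f (h *: v + (y + t *: v)) - f (y + t *: v))).
  apply/funext => h; congr (_ *: (f _ - _)).
  by rewrite scalerDl addrCA /GRing.scale /= mulr1.
move=> df; split; first by rewrite /derivable /= E; exact: df.
by rewrite /derive /= E.
Qed.

Lemma MVT_line (R : realType) (V : normedModType R) (f : V -> R) (y v : V)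
    (h : R) : 0 <= h ->
  (forall t, 0 <= t <= h -> derivable f (y + t *: v) v) ->
  exists2 t, 0 <= t <= h & f (y + h *: v) - f y = h * 'D_v f (y + t *: v).
Proof.
move=> h0 df.
have dl t : t \in `[0, h] ->
    is_derive t 1 (fun s => f (y + s *: v)) ('D_v f (y + t *: v)).
  by rewrite in_itv /= => th; apply: is_derive_line; exact: df.
pose F s := f (y + s *: v); pose dF t := 'D_v f (y + t *: v).
have F' t : t \in `]0, h[ -> is_derive t 1 F (dF t).
  by move=> th; apply: dl; exact: subset_itv_oo_cc.
have cF : {within `[0, h], continuous F}.
  by apply: derivable_within_continuous => t /dl [].
have [t th] := MVT_segment h0 F' cF.
rewrite /F scale0r addr0 subr0 mulrC => ->.
by exists t => //; move: th; rewrite in_itv.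
Qed.

Lemma nbhs_normP (R : realType) (V : normedModType R) (x : V) (P : set V) :
  nbhs x P <-> exists2 d : R, 0 < d & forall y, `|x - y| < d -> P y.
Proof.
split=> [/nbhs_ballP[d /= d0 dP]|[d d0 dP]].
  by exists d => // y xy; apply: dP; rewrite -ball_normE.
by apply/nbhs_ballP; exists d => //= y; rewrite -ball_normE => /dP.
Qed.

Lemma open_normP (R : realType) (V : normedModType R) (D : set V) (x : V) :
  open D -> D x -> exists2 d : R, 0 < d & forall y, `|x - y| < d -> D y.
Proof. by move=> oD Dx; apply/nbhs_normP; exact: open_nbhs_nbhs. Qed.

Lemma continuous_normP (R : realType) (V : normedModType R) (f : V -> R) (x : V)
    (e : R) : {for x, continuous f} -> 0 < e ->
  exists2 d : R, 0 < d & forall y, `|x - y| < d -> `|f x - f y| < e.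
Proof.
by move=> /cvgrPdist_lt cf e0; apply/nbhs_normP; exact: cf.
Qed.

(** * Symmetry of second partial derivatives *)

Section Schwarz.
Context {R : realType} {n : nat}.

Lemma norm_delta_mx (i : 'I_n) : `|delta_mx 0 i : 'rV[R]_n| <= 1.
Proof.
rewrite [leLHS]/Num.Def.normr/= mx_normrE bigmax_le // => -[a b] _ /=.
by rewrite mxE; case: andP => _; rewrite ?normr1 ?normr0.
Qed.

(** Two mean value theorems: along axis i for the increment of [f] in direction j, then along axis j
    for [partial i f]. The left-hand side of the equation is symmetric in i and j. *)
Lemma second_difference (D : set 'rV[R]_n) (f : 'rV[R]_n -> R) x i j h :
  Ck 2 D f -> 0 <= h ->
  (forall s t, 0 <= s <= h -> 0 <= t <= h ->
     D (x + s *: delta_mx 0 i + t *: delta_mx 0 j)) ->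
  exists s t, [/\ 0 <= s <= h, 0 <= t <= h &
    f (x + h *: delta_mx 0 i + h *: delta_mx 0 j) - f (x + h *: delta_mx 0 i)
    - f (x + h *: delta_mx 0 j) + f x =
    h * h * partial j (partial i f) (x + s *: delta_mx 0 i + t *: delta_mx 0 j)].
Proof.
move=> [df pf] h0 hD; have hh : 0 <= h <= h by rewrite h0 lexx.
have h00 : (0 : R) <= 0 <= h by rewrite h0 lexx.
pose u := h *: delta_mx 0 j : 'rV[R]_n.
have dfu s : 0 <= s <= h -> differentiable f (x + s *: delta_mx 0 i + u).
  by move=> sh; apply: df; apply: hD.
have dfs s : 0 <= s <= h -> differentiable f (x + s *: delta_mx 0 i).
  by move=> sh; apply: df; have := hD s 0 sh h00; rewrite scale0r addr0.
have E s : 0 <= s <= h -> is_derive (x + s *: delta_mx 0 i) (delta_mx 0 i)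
    (fun y => f (y + u) - f y)
    (partial i f (x + s *: delta_mx 0 i + u) - partial i f (x + s *: delta_mx 0 i)).
  move=> sh; apply: is_deriveB; last by apply/derivableP/diff_derivable/dfs.
  have dd := diff_derivable (v := delta_mx 0 i) (dfu s sh).
  have F : (fun h0 : R => h0^-1 *: ((fun y => f (y + u))
       (h0 *: delta_mx 0 i + (x + s *: delta_mx 0 i)) - f (x + s *: delta_mx 0 i + u)))
     = (fun h0 : R => h0^-1 *: (f
       (h0 *: delta_mx 0 i + (x + s *: delta_mx 0 i + u)) - f (x + s *: delta_mx 0 i + u))).
    by apply/funext => k; rewrite !addrA.
  split; first by rewrite /derivable /= F; exact: dd.
  by rewrite /partial /derive /= F.
have [s sh Es] := @MVT_line R _ (fun y => f (y + u) - f y) x (delta_mx 0 i) h h0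
   (fun s sh => @ex_derive _ _ _ _ _ _ _ (E s sh)).
rewrite (@derive_val _ _ _ _ _ _ _ (E s sh)) in Es.
have [df1 _] := pf i.
have [t th Et] := @MVT_line R _ (partial i f) (x + s *: delta_mx 0 i)
   (delta_mx 0 j) h h0 (fun t th => diff_derivable (df1 _ (hD s t sh th))).
exists s, t; split=> //.
rewrite -/u in Et; rewrite Et mulrA in Es; rewrite -Es /u.
by rewrite -[in RHS]addrA opprD opprK !addrA.
Qed.

(** By the symmetry of the second difference the two mixed derivatives agree at two points
    arbitrarily close to x; continuity moves both points to x. *)
Lemma partialC (D : set 'rV[R]_n) (f : 'rV[R]_n -> R) x i j :
  open D -> Ck 2 D f -> D x ->
  partial i (partial j f) x = partial j (partial i f) x.
Proof.
move=> oD Cf Dx.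
apply/eqP; rewrite -subr_eq0 -normr_le0; apply/ler_addgt0Pr => e e0; rewrite add0r.
have [_ pf] := Cf.
have [[_ pj] [_ pi]] := (pf j, pf i).
have cij := pj i x Dx; have cji := pi j x Dx.
have e2 : 0 < e / 2 by rewrite divr_gt0.
have [d1 d10 H1] := open_normP oD Dx.
have [d2 d20 H2] := continuous_normP cij e2.
have [d3 d30 H3] := continuous_normP cji e2.
pose d := Num.min d1 (Num.min d2 d3).
have d0 : 0 < d by rewrite !lt_min d10 d20 d30.
have bd y : `|x - y| < d -> [/\ D y,
    `|partial i (partial j f) x - partial i (partial j f) y| < e / 2 &
    `|partial j (partial i f) x - partial j (partial i f) y| < e / 2].
  move=> xy; have : [&& `|x - y| < d1, `|x - y| < d2 & `|x - y| < d3].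
    by rewrite -!lt_min.
  by case/and3P=> h1 h2 h3; exact: And3 (H1 _ h1) (H2 _ h2) (H3 _ h3).
(* Two steps of length at most [h] must stay within distance [d]. *)
pose h := d / 3.
have h0 : 0 < h by rewrite divr_gt0.
have bh a b s t : 0 <= s <= h -> 0 <= t <= h ->
    `|x - (x + s *: delta_mx 0 a + t *: delta_mx 0 b)| < d.
  move=> /andP[s0 sh] /andP[t0 th].
  rewrite -addrA opprD addNKr normrN.
  apply: (@le_lt_trans _ _ (h + h)); last by rewrite /h; lra.
  apply: le_trans (ler_normD _ _) _; rewrite !normrZ !ger0_norm //.
  apply: lerD; [apply: le_trans sh|apply: le_trans th];
    by rewrite ler_piMr // norm_delta_mx.
have [s [t [sh th E1]]] := second_difference (i := i) (j := j) Cf (ltW h0)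
   (fun s t sh th => let: And3 z _ _ := bd _ (bh i j s t sh th) in z).
have [s' [t' [sh' th' E2]]] := second_difference (i := j) (j := i) Cf (ltW h0)
   (fun s t sh th => let: And3 z _ _ := bd _ (bh j i s t sh th) in z).
have E : partial j (partial i f) (x + s *: delta_mx 0 i + t *: delta_mx 0 j)
   = partial i (partial j f) (x + s' *: delta_mx 0 j + t' *: delta_mx 0 i).
  apply: (@mulfI _ (h * h)); first by rewrite mulf_neq0 // gt_eqF.
  apply: etrans (esym E1) _; apply: etrans _ E2.
  by rewrite (addrAC x); congr (_ + _); exact: addrAC.
have [_ _ b1] := bd _ (bh i j s t sh th).
have [_ b2 _] := bd _ (bh j i s' t' sh' th').
rewrite E in b1; rewrite distrC in b1.
rewrite (splitr e); apply: le_trans (ltW (ltrD b2 b1)).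
exact: ler_distD.
Qed.

End Schwarz.

(** * Curvature in coordinates *)

Lemma mxDE (R : nmodType) (m p : nat) (A B : 'M[R]_(m, p)) i j :
  (A + B) i j = A i j + B i j.
Proof. exact: mxE. Qed.

Lemma mxNE (R : zmodType) (m p : nat) (A : 'M[R]_(m, p)) i j :
  (- A) i j = - A i j.
Proof. exact: mxE. Qed.

Lemma mxBE (R : zmodType) (m p : nat) (A B : 'M[R]_(m, p)) i j :
  (A - B) i j = A i j - B i j.
Proof. by rewrite mxDE mxNE. Qed.

Lemma trmxD (R : nmodType) (m p : nat) (A B : 'M[R]_(m, p)) :
  (A + B)^T = A^T + B^T.
Proof. by apply/matrixP => i j; rewrite !mxE. Qed.

Lemma trmxB (R : zmodType) (m p : nat) (A B : 'M[R]_(m, p)) :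
  (A - B)^T = A^T - B^T.
Proof. by apply/matrixP => i j; rewrite !mxE. Qed.

Lemma mxME (R : pzSemiRingType) (m p q : nat) (A : 'M[R]_(m, p)) (B : 'M[R]_(p, q)) i j :
  (A *m B) i j = \sum_k A i k * B k j.
Proof. exact: mxE. Qed.

(* Locked: otherwise unification unfolds derivatives down to filters. *)
HB.lock Definition dmx (R : realType) (n : nat) (i : 'I_n)
    (A : 'rV[R]_n -> 'M[R]_n) (x : 'rV[R]_n) : 'M[R]_n :=
  \matrix_(a, b) partial i (fun y => A y a b) x.

Section MatrixDerivative.
Context {R : realType} {n : nat} {U : set 'rV[R]_n}.
Hypothesis oU : open U.
Implicit Types (A B : 'rV[R]_n -> 'M[R]_n) (x : 'rV[R]_n) (i j : 'I_n).

(** Entrywise, so that the scalar rules apply directly. *)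
Definition Ckmx k A := forall a b, Ck k U (fun y => A y a b).

Lemma dmxE i A x a b : dmx i A x a b = partial i (fun y => A y a b) x.
Proof. by rewrite dmx.unlock mxE. Qed.

Lemma Ckmx_diff k A x a b : Ckmx k.+1 A -> U x -> differentiable (fun y => A y a b) x.
Proof. by move=> CA Ux; have [+ _] := CA a b; apply. Qed.

Lemma Ckmx_dmx k i A : Ckmx k.+1 A -> Ckmx k (dmx i A).
Proof.
move=> CA a b; have [_ pA] := CA a b.
by apply: Ck_ext (pA i) => // x Ux; rewrite dmxE.
Qed.

Lemma CkmxD k A B : Ckmx k A -> Ckmx k B -> Ckmx k (fun y => A y + B y).
Proof.
move=> CA CB a b; apply: Ck_ext (CkD oU (CA a b) (CB a b)) => // x Ux.
by rewrite mxE.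
Qed.

Lemma CkmxB k A B : Ckmx k A -> Ckmx k B -> Ckmx k (fun y => A y - B y).
Proof.
move=> CA CB a b; apply: Ck_ext (CkB oU (CA a b) (CB a b)) => // x Ux.
by rewrite !mxE.
Qed.

Lemma CkmxM k A B : Ckmx k A -> Ckmx k B -> Ckmx k (fun y => A y *m B y).
Proof.
move=> CA CB a b.
have := Ck_big_sum oU (index_enum 'I_n) predT
  (fun l => CkM oU (CA a l) (CB l b)).
by apply: Ck_ext => // x Ux; rewrite mxE.
Qed.

Lemma CkmxT k A : Ckmx k A -> Ckmx k (fun y => (A y)^T).
Proof. by move=> CA a b; apply: Ck_ext (CA b a) => // x Ux; rewrite mxE. Qed.

Lemma dmx_ext i A B x : (forall x, U x -> A x = B x) -> U x ->
  dmx i A x = dmx i B x.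
Proof.
move=> AB Ux; apply/matrixP => a b; rewrite !dmxE; apply: near_eq_partial.
by apply: filterS (open_nbhs_nbhs (conj oU Ux)) => y Uy; rewrite AB.
Qed.

Lemma dmxD i k A B x : Ckmx k.+1 A -> Ckmx k.+1 B -> U x ->
  dmx i (fun y => A y + B y) x = dmx i A x + dmx i B x.
Proof.
move=> CA CB Ux; apply/matrixP => a b; rewrite mxDE !dmxE.
rewrite -partialD; [|exact: Ckmx_diff CA Ux|exact: Ckmx_diff CB Ux].
by congr (partial _ _ _); apply/funext => y; rewrite mxE.
Qed.

Lemma dmxB i k A B x : Ckmx k.+1 A -> Ckmx k.+1 B -> U x ->
  dmx i (fun y => A y - B y) x = dmx i A x - dmx i B x.
Proof.
move=> CA CB Ux; apply/matrixP => a b; rewrite mxBE !dmxE.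
rewrite -partialB; [|exact: Ckmx_diff CA Ux|exact: Ckmx_diff CB Ux].
by congr (partial _ _ _); apply/funext => y; rewrite !mxE.
Qed.

Lemma dmxM i k A B x : Ckmx k.+1 A -> Ckmx k.+1 B -> U x ->
  dmx i (fun y => A y *m B y) x = dmx i A x *m B x + A x *m dmx i B x.
Proof.
move=> CA CB Ux; apply/matrixP => a b; rewrite dmxE mxDE !mxME -big_split /=.
have dA l := Ckmx_diff a l CA Ux; have dB l := Ckmx_diff l b CB Ux.
rewrite [LHS](_ : _ = partial i (fun y => \sum_l A y a l * B y l b) x); last first.
  by congr (partial _ _ _); apply/funext => y; rewrite mxE.
rewrite partial_sum; last by move=> l; exact: differentiableM.
by apply: eq_bigr => l _; rewrite partialM // !dmxE.
Qed.

Lemma dmxT i A x : dmx i (fun y => (A y)^T) x = (dmx i A x)^T.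
Proof.
apply/matrixP => a b; rewrite dmxE [RHS]mxE dmxE; congr (partial _ _ _).
by apply/funext => y; rewrite mxE.
Qed.

Lemma dmxC i j A x : Ckmx 2 A -> U x -> dmx i (dmx j A) x = dmx j (dmx i A) x.
Proof.
move=> CA Ux; apply/matrixP => a b.
have E p q : dmx p (dmx q A) x a b = partial p (partial q (fun y => A y a b)) x.
  by rewrite dmxE; congr (partial _ _ _); apply/funext => y; exact: dmxE.
exact: etrans (E i j) (etrans (partialC i j oU (CA a b) Ux) (esym (E j i))).
Qed.

End MatrixDerivative.

(** Row j holds the components of nabla_i d_j, in keeping with tangent vectors being rows. *)
HB.lock Definition conn (R : realType) (n : nat) (G : 'rV[R]_n -> 'M[R]_n)
    (i : 'I_n) (x : 'rV[R]_n) : 'M[R]_n :=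
  \matrix_(j, k) christoffel G k i j x.

(** Row k holds the components of R(d_i, d_j) d_k. Matrices acting on rows compose in reverse order,
    whence the sign of the commutator. *)
HB.lock Definition curv (R : realType) (n : nat) (G : 'rV[R]_n -> 'M[R]_n)
    (i j : 'I_n) (x : 'rV[R]_n) : 'M[R]_n :=
  dmx i (conn G j) x - dmx j (conn G i) x
  + conn G j x *m conn G i x - conn G i x *m conn G j x.

(** Entry (k, l) is Rm(d_i, d_j, d_k, d_l). *)
HB.lock Definition curv_low (R : realType) (n : nat) (G : 'rV[R]_n -> 'M[R]_n)
    (i j : 'I_n) (x : 'rV[R]_n) : 'M[R]_n := curv G i j x *m G x.

Section Curvature.
Context {R : realType} {n : nat} {U : set 'rV[R]_n} {G : 'rV[R]_n -> 'M[R]_n}.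
Hypothesis oU : open U.
Hypothesis G_smooth : smooth_on U G.
Hypothesis G_sym : forall x, U x -> (G x)^T = G x.
Hypothesis G_pos : forall x v, U x -> v != 0 -> 0 < inner G x v v.
Implicit Types (x : 'rV[R]_n) (i j k l : 'I_n).

Local Notation conn := (conn G).
Local Notation curv := (curv G).
Local Notation curv_low := (curv_low G).

Lemma connE i x j k : conn i x j k = christoffel G k i j x.
Proof. by rewrite conn.unlock mxE. Qed.

Lemma curv_fun i j : curv i j = fun x =>
  dmx i (conn j) x - dmx j (conn i) x + conn j x *m conn i x - conn i x *m conn j x.
Proof. by apply/funext => x; rewrite curv.unlock. Qed.

Lemma curv_low_fun i j : curv_low i j = fun x => curv i j x *m G x.
Proof. by apply/funext => x; rewrite curv_low.unlock. Qed.

Lemma curvE i j k l x : curv i j x k l = curvature_coef G i j k l x.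
Proof.
have E p q r : (fun y => conn p y q r) = christoffel G r p q.
  by apply/funext => y; rewrite connE.
rewrite curv.unlock mxBE mxDE mxBE !dmxE !mxME /curvature_coef !E sumrB -addrA.
by congr (_ + (_ - _)); apply: eq_bigr => m _; rewrite !connE mulrC.
Qed.

Lemma G_unit x : U x -> G x \in unitmx.
Proof.
move=> Ux; rewrite unitmxE unitfE; apply/det0P => -[v v0 vG].
by have := G_pos Ux v0; rewrite /inner vG mul0mx mxE ltxx.
Qed.

Lemma Ckmx_G (k : nat) : Ckmx (U := U) k G.
Proof. by move=> a b; apply: Ck_entry. Qed.

Lemma Ckmx_conn (k : nat) i : Ckmx (U := U) k (conn i).
Proof.
move=> j l; pose b l m y := partial i (fun y => G y j m) y
    + partial j (fun y => G y i m) y - partial m (fun y => G y i j) y.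
apply: (@Ck_ext _ _ _ oU _ _ (fun y => 2^-1 * \sum_m invmx (G y) l m * b l m y)).
  by move=> x Ux; rewrite connE.
apply: CkZ => //; apply: Ck_big_sum => // m; apply: CkM => //.
  apply: Ck_invmx => //; first exact: G_unit.
  by move=> a c; exact: Ckmx_G.
have dG p c d : Ck k U (partial p (fun y => G y c d)).
  by have [_ +] := @Ckmx_G k.+1 c d; apply.
by apply: CkB => //; apply: CkD.
Qed.

Lemma Ckmx_curv (k : nat) i j : Ckmx (U := U) k (curv i j).
Proof.
rewrite curv.unlock; apply: CkmxB => //; last by apply: CkmxM => //; exact: Ckmx_conn.
apply: CkmxD => //; last by apply: CkmxM => //; exact: Ckmx_conn.
by apply: CkmxB => //; apply: Ckmx_dmx => //; exact: Ckmx_conn.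
Qed.

Lemma Ckmx_curv_low (k : nat) i j : Ckmx (U := U) k (curv_low i j).
Proof. by rewrite curv_low.unlock; apply: CkmxM => //; [exact: Ckmx_curv | exact: Ckmx_G]. Qed.

(** The Koszul formula for coordinate fields: the inverse matrix in [christoffel] cancels against
    [G]. *)
Lemma conn_lower i j k x : U x ->
  (conn i x *m G x) j k = 2^-1 * (dmx i G x j k + dmx j G x i k - dmx k G x i j).
Proof.
move=> Ux; rewrite mxME.
under eq_bigr => m _ do rewrite connE /christoffel -mulrA mulr_suml.
rewrite -mulr_sumr; congr (_ * _); rewrite exchange_big /=.
under eq_bigr => l _.
  under eq_bigr => m _ do rewrite mulrAC.
  rewrite -mulr_suml; over.
have inv l : \sum_m invmx (G x) m l * G x m k = (l == k)%:R.
  rewrite -[RHS](_ : (1%:M : 'M[R]_n) k l = _); last by rewrite mxE eq_sym.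
  rewrite -(mulmxV (G_unit Ux)) mxE; apply: eq_bigr => m _.
  by rewrite mulrC; congr (_ * _); rewrite -{1}(G_sym Ux) mxE.
under eq_bigr => l _ do rewrite inv.
rewrite (bigD1 k) //= big1 ?addr0; last first.
  by move=> l /negPf lk; rewrite lk mul0r.
by rewrite eqxx mul1r !dmxE.
Qed.

Lemma dG_sym p i j x : U x -> dmx p G x i j = dmx p G x j i.
Proof.
move=> Ux; rewrite -[in LHS](dmx_ext oU p (A := fun y => (G y)^T) G_sym Ux).
by rewrite dmxT mxE.
Qed.

Lemma conn_metric i x : U x ->
  dmx i G x = conn i x *m G x + G x *m (conn i x)^T.
Proof.
move=> Ux; rewrite -{2}(G_sym Ux) -trmx_mul; apply/matrixP => j k.
rewrite mxDE [X in _ + X]mxE !conn_lower //.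
rewrite (dG_sym i j k) //.
by field.
Qed.

Lemma conn_sym i j k x : U x -> conn i x j k = conn j x i k.
Proof.
move=> Ux; rewrite !connE /christoffel; congr (_ * _); apply: eq_bigr => l _.
congr (_ * _); rewrite [in RHS](addrC (partial j _ _)); congr (_ - _).
by have := dG_sym l i j Ux; rewrite !dmxE.
Qed.

Lemma curv_anti i j x : curv i j x = - curv j i x.
Proof. by apply/matrixP => k l; rewrite curv.unlock !(mxDE, mxNE); ring. Qed.

Lemma curv_low_anti12 i j x : curv_low i j x = - curv_low j i x.
Proof. by rewrite curv_low.unlock (curv_anti i j) mulNmx. Qed.

(** Second derivatives of [G] commute. Expressed through [conn_metric] applied twice, their
    commutator is [curv_low i j x] plus its transpose. *)
Lemma curv_low_anti34 i j x : U x -> (curv_low i j x)^T = - curv_low i j x.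
Proof.
move=> Ux.
have C1 k := Ckmx_conn 1 k.
have C2 k := CkmxM oU (C1 k) (Ckmx_G 1).
have C3 k := CkmxM oU (Ckmx_G 1) (CkmxT oU (C1 k)).
have dd p q : dmx p (dmx q G) x =
    dmx p (conn q) x *m G x + conn q x *m (conn p x *m G x + G x *m (conn p x)^T)
    + ((conn p x *m G x + G x *m (conn p x)^T) *m (conn q x)^T
       + G x *m (dmx p (conn q) x)^T).
  rewrite (dmx_ext oU p (conn_metric q) Ux).
  rewrite (dmxD p (C2 q) (C3 q) Ux) (dmxM p (C1 q) (Ckmx_G 1) Ux).
  by rewrite (dmxM p (Ckmx_G 1) (CkmxT oU (C1 q)) Ux) dmxT conn_metric.
have := dmxC oU i j (Ckmx_G 2) Ux; rewrite !dd => E.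
rewrite curv_low.unlock trmx_mul (G_sym Ux) curv.unlock !(trmxB, trmxD) !trmx_mul.
rewrite !(mulmxDl, mulmxDr, mulmxBl, mulmxBr, mulNmx, mulmxN, mulmxA) in E *.
apply/matrixP => k l; move/matrixP/(_ k l): E; rewrite !(mxDE, mxNE) => E.
lra.
Qed.

(** Torsion-freeness ([conn_sym]) exchanges the index of the connection matrix with its row index,
    after which the terms cancel in pairs. *)
Lemma curv_bianchi1 i j k l x : U x ->
  curv i j x k l + curv j k x i l + curv k i x j l = 0.
Proof.
move=> Ux.
have S1 p q r : dmx p (conn q) x r l = dmx p (conn r) x q l.
  rewrite !dmxE; apply: near_eq_partial.
  by apply: filterS (open_nbhs_nbhs (conj oU Ux)) => y Uy; exact: conn_sym.
have S2 p q r : (conn p x *m conn q x) r l = (conn r x *m conn q x) p l.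
  by rewrite !mxME; apply: eq_bigr => m _; rewrite conn_sym.
rewrite curv.unlock !(mxDE, mxNE).
rewrite (S1 i k j) (S1 j i k) (S1 k j i) (S2 j i k) (S2 i k j) (S2 k j i).
ring.
Qed.

Lemma curv_low_bianchi1 i j k l x : U x ->
  curv_low i j x k l + curv_low j k x i l + curv_low k i x j l = 0.
Proof.
move=> Ux; rewrite curv_low.unlock !mxME -!big_split big1 //= => m _.
by rewrite -!mulrDl curv_bianchi1 // mul0r.
Qed.

(** The second derivatives of the connection cancel in the cyclic sum by symmetry; what remains is a
    polynomial identity between matrices. *)
Lemma curv_bianchi2 i j k x : U x ->
  dmx i (curv j k) x + dmx j (curv k i) x + dmx k (curv i j) x =
  conn i x *m curv j k x - curv j k x *m conn i x
  + (conn j x *m curv k i x - curv k i x *m conn j x)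
  + (conn k x *m curv i j x - curv i j x *m conn k x).
Proof.
move=> Ux; have C p := Ckmx_conn 1 p.
have Cd p q : Ckmx (U := U) 1 (dmx p (conn q)) by apply: Ckmx_dmx => //; exact: Ckmx_conn.
have CM p q := CkmxM oU (C p) (C q).
have d p q r : dmx p (curv q r) x =
    dmx p (dmx q (conn r)) x - dmx p (dmx r (conn q)) x
    + (dmx p (conn r) x *m conn q x + conn r x *m dmx p (conn q) x)
    - (dmx p (conn q) x *m conn r x + conn q x *m dmx p (conn r) x).
  rewrite curv_fun (dmxB p (CkmxD oU (CkmxB oU (Cd q r) (Cd r q)) (CM r q)) (CM q r) Ux).
  rewrite (dmxD p (CkmxB oU (Cd q r) (Cd r q)) (CM r q) Ux).
  by rewrite (dmxB p (Cd q r) (Cd r q) Ux) !(dmxM p (C _) (C _) Ux).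
rewrite !d (dmxC oU j i (Ckmx_conn 2 k) Ux) (dmxC oU k i (Ckmx_conn 2 j) Ux).
rewrite (dmxC oU k j (Ckmx_conn 2 i) Ux) curv.unlock.
rewrite !(mulmxDl, mulmxDr, mulmxBl, mulmxBr, mulNmx, mulmxN, mulmxA).
by apply/matrixP => a b; rewrite !(mxDE, mxNE); ring.
Qed.

(** Metric compatibility turns the commutators of [curv_bianchi2] into these symmetric products. No
    derivative of the curvature is left on the right, so the cyclic sum is controlled by the
    curvature itself. *)
Lemma curv_low_bianchi2 i j k x : U x ->
  dmx i (curv_low j k) x + dmx j (curv_low k i) x + dmx k (curv_low i j) x =
  conn i x *m curv_low j k x + curv_low j k x *m (conn i x)^T
  + (conn j x *m curv_low k i x + curv_low k i x *m (conn j x)^T)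
  + (conn k x *m curv_low i j x + curv_low i j x *m (conn k x)^T).
Proof.
move=> Ux; have d p q r : dmx p (curv_low q r) x = dmx p (curv q r) x *m G x
    + curv q r x *m (conn p x *m G x + G x *m (conn p x)^T).
  by rewrite curv_low_fun (dmxM p (Ckmx_curv 1 q r) (Ckmx_G 1) Ux) conn_metric.
rewrite !d; have /(congr1 (mulmx^~ (G x))) /= := curv_bianchi2 i j k Ux.
rewrite curv_low.unlock.
rewrite !(mulmxDl, mulmxDr, mulmxBl, mulmxBr, mulNmx, mulmxN, mulmxA).
move=> E; apply/matrixP => a b; move/matrixP/(_ a b): E; rewrite !(mxDE, mxNE).
lra.
Qed.

End Curvature.

(** * Algebraic curvature tensors *)

Section Bilinear.
Context {R : realFieldType} {n : nat}.
Implicit Types (A : 'M[R]_n) (u v w : 'rV[R]_n) (t : R).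

(** At [A = G x] this is convertible with [inner G x], so facts about the metric apply as they
    stand. *)
Definition bil A u v : R := (u *m A *m v^T) 0 0.

Lemma bilE A u v : bil A u v = \sum_i \sum_j u 0 i * A i j * v 0 j.
Proof.
rewrite /bil mxE exchange_big; apply: eq_bigr => j _ /=.
by rewrite !mxE mulr_suml.
Qed.

Lemma bilDl A u v w : bil A (u + v) w = bil A u w + bil A v w.
Proof. by rewrite /bil !mulmxDl mxE. Qed.

Lemma bilDr A u v w : bil A w (u + v) = bil A w u + bil A w v.
Proof. by rewrite /bil linearD /= mulmxDr mxE. Qed.

Lemma bilZl A t u w : bil A (t *: u) w = t * bil A u w.
Proof. by rewrite /bil -!scalemxAl mxE. Qed.

Lemma bilZr A t u w : bil A w (t *: u) = t * bil A w u.
Proof. by rewrite /bil linearZ /= -scalemxAr mxE. Qed.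

Lemma bilNl A u w : bil A (- u) w = - bil A u w.
Proof. by rewrite -scaleN1r bilZl mulN1r. Qed.

Lemma bilNr A u w : bil A w (- u) = - bil A w u.
Proof. by rewrite -scaleN1r bilZr mulN1r. Qed.

Lemma bil_sym A u v : A^T = A -> bil A u v = bil A v u.
Proof.
move=> sA; rewrite /bil.
transitivity ((u *m A *m v^T)^T 0 0); first by rewrite [RHS]mxE.
by rewrite !trmx_mul trmxK sA mulmxA.
Qed.

Lemma bil0l A u : bil A 0 u = 0.
Proof. by rewrite -(scale0r 0) bilZl mul0r. Qed.

Lemma bil_delta A i j : bil A (delta_mx 0 i) (delta_mx 0 j) = A i j.
Proof. by rewrite /bil -rowE trmx_delta -colE !mxE. Qed.

Definition dot u v : R := bil 1%:M u v.

Lemma dotE u v : dot u v = \sum_i u 0 i * v 0 i.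
Proof. by rewrite /dot /bil mulmx1 mxE; apply: eq_bigr => i _; rewrite mxE. Qed.

Lemma dotC u v : dot u v = dot v u.
Proof. by apply: bil_sym; exact: trmx1. Qed.

Lemma dot_ge0 u : 0 <= dot u u.
Proof. by rewrite dotE sumr_ge0 // => i _; rewrite -expr2 sqr_ge0. Qed.

Lemma dot_eq0 u : dot u u = 0 -> u = 0.
Proof.
rewrite dotE => /eqP; rewrite psumr_eq0; last by move=> i _; rewrite -expr2 sqr_ge0.
move=> /allP u0; apply/rowP => i; rewrite mxE; apply/eqP.
by have := u0 i (mem_index_enum _); rewrite /= mulf_eq0 orbb.
Qed.

Lemma dot_gt0 u : u != 0 -> 0 < dot u u.
Proof.
by move=> u0; rewrite lt_neqAle dot_ge0 andbT eq_sym; apply: contra u0 => /eqP/dot_eq0/eqP.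
Qed.

(** The Gram determinant, that is, the denominator of [sectional]. *)
Definition area A u v : R := bil A u u * bil A v v - bil A u v ^+ 2.

Lemma area_shear A t u v : A^T = A -> area A u (v - t *: u) = area A u v.
Proof.
move=> sA; rewrite /area !(bilDl, bilDr, bilNl, bilNr, bilZl, bilZr) (bil_sym v u sA).
ring.
Qed.

Definition perp A u v := v - (bil A u v / bil A u u) *: u.

Lemma bil_perp A u v : bil A u u != 0 -> bil A u (perp A u v) = 0.
Proof. by move=> u0; rewrite /perp bilDr bilNr bilZr divfK // subrr. Qed.

Lemma areaE A u v : A^T = A -> bil A u u != 0 ->
  area A u v = bil A u u * bil A (perp A u v) (perp A u v).
Proof.
move=> sA u0; rewrite -(area_shear (bil A u v / bil A u u) u v sA) -/(perp A u v).
by rewrite /area bil_perp // expr0n subr0.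
Qed.

Lemma area0l A v : area A 0 v = 0.
Proof. by rewrite /area !bil0l mul0r expr0n subr0. Qed.

Lemma area_scale A t u : area A u (t *: u) = 0.
Proof. by rewrite /area !(bilZl, bilZr); ring. Qed.

Section Positive.
Variable A : 'M[R]_n.
Hypothesis sA : A^T = A.
Hypothesis pA : forall v, v != 0 -> 0 < bil A v v.

Lemma bil_ge0 v : 0 <= bil A v v.
Proof.
by have [->|/pA/ltW //] := eqVneq v 0; rewrite bil0l.
Qed.

(** Gram-Schmidt separates the dependent pairs, on which area and curvature both vanish, from those
    spanning a plane; this extends estimates on planes to all pairs. *)
Lemma perp_cases u v : [\/ u = 0, exists t, v = t *: u | 0 < area A u v].
Proof.
have [->|u0] := eqVneq u 0; first exact: Or31.
have Au := pA u0.
have [z0|z0] := eqVneq (perp A u v) 0.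
  by apply: Or32; exists (bil A u v / bil A u u); apply/eqP; rewrite -subr_eq0; apply/eqP.
by apply: Or33; rewrite areaE ?gt_eqF // mulr_gt0 // pA.
Qed.

Lemma area_ge0 u v : 0 <= area A u v.
Proof.
have [->|[t ->]|/ltW //] := perp_cases u v; first by rewrite area0l.
by rewrite area_scale.
Qed.

Lemma area_gt0_free u v : 0 < area A u v -> row_free (col_mx u v).
Proof.
move=> a0; rewrite -kermx_eq0; apply/eqP/row_matrixP => i; rewrite row0.
have : row i (kermx (col_mx u v)) *m col_mx u v = 0.
  by rewrite -row_mul mulmx_ker row0.
move: (row i _) => w; rewrite -[w]hsubmxK mul_row_col.
set a := lsubmx w; set b := rsubmx w.
rewrite (mx11_scalar a) (mx11_scalar b) !mul_scalar_mx.
move: (a 0 0) (b 0 0) => {a b}a b E.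
have b0 : b = 0.
  apply/eqP/negPn/negP => b0.
  have : v = (- a / b) *: u.
    apply: (scalerI b0); rewrite scalerA mulrCA divff // mulr1 scaleNr.
    by apply/eqP; rewrite -subr_eq0 opprK addrC E.
  by move=> vE; move: a0; rewrite vE area_scale ltxx.
move: E; rewrite b0 scale0r addr0 => /eqP; rewrite scaler_eq0 => /orP[/eqP->|/eqP u0].
  by rewrite !raddf0 row_mx0.
by move: a0; rewrite u0 area0l ltxx.
Qed.

Lemma area_le u v : area A u v <= bil A u u * bil A v v.
Proof. by rewrite /area gerBl sqr_ge0. Qed.

(** Let z be the part of v that is A-orthogonal to u. The A-area is the product of the squared
    A-norms of u and z, and a shear preserves the Euclidean area, which is at most the product of
    their Euclidean ones. Each factor costs one [lam]. *)
Lemma area_lower lam u v : 0 <= lam -> (forall v, lam * dot v v <= bil A v v) ->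
  lam ^+ 2 * area 1%:M u v <= area A u v.
Proof.
move=> l0 lA; have [->|u0] := eqVneq u 0; first by rewrite !area0l mulr0.
have Au := pA u0; rewrite (areaE v sA) ?gt_eqF //.
set z := perp A u v.
have -> : area 1%:M u v = area 1%:M u z by rewrite area_shear ?trmx1.
apply: (@le_trans _ _ ((lam * dot u u) * (lam * dot z z))).
  rewrite mulrACA -expr2 ler_wpM2l ?sqr_ge0 // /area /dot gerBl sqr_ge0 //.
by apply: ler_pM; rewrite ?lA ?mulr_ge0 ?dot_ge0.
Qed.

End Positive.
End Bilinear.

(** * Polarization and Euclidean contractions of a curvature tensor *)

Section Form4.
Context {R : realFieldType} {n : nat}.
Implicit Types (r : 'I_n -> 'I_n -> 'I_n -> 'I_n -> R) (u v w z : 'rV[R]_n).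

(** One sum over quadruples rather than four nested sums, so that linearity in each argument is a
    single splitting. *)
Definition form4 r u v w z : R :=
  \sum_(p : 'I_n * 'I_n * 'I_n * 'I_n)
    u 0 p.1.1.1 * v 0 p.1.1.2 * w 0 p.1.2 * z 0 p.2 * r p.1.1.1 p.1.1.2 p.1.2 p.2.

Lemma sum4E (F : 'I_n * 'I_n * 'I_n * 'I_n -> R) :
  \sum_p F p = \sum_i \sum_j \sum_k \sum_l F (i, j, k, l).
Proof. by rewrite !pair_bigA; apply: eq_bigr => -[[[i j] k] l] _. Qed.

Lemma form4D1 r u u' v w z : form4 r (u + u') v w z = form4 r u v w z + form4 r u' v w z.
Proof. by rewrite -big_split; apply: eq_bigr => p _ /=; rewrite mxE; ring. Qed.

Lemma form4D2 r u v v' w z : form4 r u (v + v') w z = form4 r u v w z + form4 r u v' w z.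
Proof. by rewrite -big_split; apply: eq_bigr => p _ /=; rewrite mxE; ring. Qed.

Lemma form4D3 r u v w w' z : form4 r u v (w + w') z = form4 r u v w z + form4 r u v w' z.
Proof. by rewrite -big_split; apply: eq_bigr => p _ /=; rewrite mxE; ring. Qed.

Lemma form4D4 r u v w z z' : form4 r u v w (z + z') = form4 r u v w z + form4 r u v w z'.
Proof. by rewrite -big_split; apply: eq_bigr => p _ /=; rewrite mxE; ring. Qed.

Lemma form4_delta r i j k l :
  form4 r (delta_mx 0 i) (delta_mx 0 j) (delta_mx 0 k) (delta_mx 0 l) = r i j k l.
Proof.
rewrite /form4 (bigD1 (i, j, k, l)) //= !mxE !eqxx !mul1r big1 ?addr0 //.
move=> [[[i' j'] k'] l'] /=; rewrite !xpair_eqE !mxE !eqxx /= => /negP ne.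
case: eqP ne => [->|_]; last by rewrite !mul0r.
case: eqP => [->|_]; last by rewrite !(mul0r, mulr0).
case: eqP => [->|_]; last by rewrite !(mul0r, mulr0).
case: eqP => [->|_]; last by rewrite !(mul0r, mulr0).
by case.
Qed.

Lemma form4Z2 r t u v w z : form4 r u (t *: v) w z = t * form4 r u v w z.
Proof. by rewrite /form4 mulr_sumr; apply: eq_bigr => p _ /=; rewrite mxE; ring. Qed.

Section Symmetries.
Variable r : 'I_n -> 'I_n -> 'I_n -> 'I_n -> R.
Hypothesis r12 : forall i j k l, r i j k l = - r j i k l.
Hypothesis r34 : forall i j k l, r i j k l = - r i j l k.
Hypothesis rB : forall i j k l, r i j k l + r j k i l + r k i j l = 0.

Lemma form4_swap12 u v w z : form4 r u v w z = - form4 r v u w z.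
Proof.
rewrite /form4 !sum4E /= exchange_big /= -sumrN; apply: eq_bigr => i _.
rewrite -sumrN; apply: eq_bigr => j _; rewrite -sumrN; apply: eq_bigr => k _.
by rewrite -sumrN; apply: eq_bigr => l _; rewrite r12; ring.
Qed.

Lemma form4_collinear t u w z : form4 r u (t *: u) w z = 0.
Proof.
by rewrite form4Z2 (_ : form4 r u u w z = 0) ?mulr0 //; have := form4_swap12 u u w z; lra.
Qed.

(** The octahedron argument: four instances of the first Bianchi identity, reduced by the
    antisymmetries, combine linearly. *)
Lemma r_pair i j k l : r i j k l = r k l i j.
Proof.
have := rB i j k l; have := rB j k l i; have := rB k l i j; have := rB l i j k.
have := r34 j k l i; have := r34 k l j i; have := r12 l j k i.
have := r34 j l k i; have := r34 l i k j; have := r12 i k l j.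
have := r34 k i l j; have := r34 i j l k; lra.
Qed.

Lemma r_swap i j k l : r i j k l = r j i l k.
Proof. by rewrite r12 r34 opprK. Qed.

Lemma r_rev i j k l : r i j k l = r l k j i.
Proof. by rewrite r_pair r_swap. Qed.

Definition quad u v : R := form4 r u v v u.

Lemma quad_delta i j : quad (delta_mx 0 i) (delta_mx 0 j) = r i j j i.
Proof. exact: form4_delta. Qed.

Section Polarization.
Variable B : R.
Hypothesis B1 : forall i j, `|r i j j i| <= B.
Hypothesis B2 : forall i l j,
  `|quad (delta_mx 0 i + delta_mx 0 l) (delta_mx 0 j)| <= B.
Hypothesis B3 : forall i l j k,
  `|quad (delta_mx 0 i + delta_mx 0 l) (delta_mx 0 j + delta_mx 0 k)| <= B.

(** Polarizing the outer pair bounds r_ijjl by 3/2 B; polarizing the inner pair as well bounds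
    r_ijkl + r_ikjl by 9/2 B. By the Bianchi identity the difference of two such sums is 3
    r_ijkl. *)
Lemma polarization i j k l : `|r i j k l| <= 3 * B.
Proof.
have Q2 i' l' j' : `|r i' j' j' l'| <= 3 / 2 * B.
  move: (B2 i' l' j') (B1 i' j') (B1 l' j').
  rewrite /quad !(form4D1, form4D4) !form4_delta (r_rev l' j' j' i').
  by rewrite !ler_norml; lra.
have Q3 i' l' j' k' : `|r i' j' k' l' + r i' k' j' l'| <= 9 / 2 * B.
  move: (B3 i' l' j' k') (B2 j' k' i') (B2 j' k' l') (Q2 i' l' j') (Q2 i' l' k').
  rewrite /quad !(form4D1, form4D4, form4D2, form4D3) !form4_delta.
  have := r_swap i' j' j' i'; have := r_swap i' j' k' i'.
  have := r_swap i' k' j' i'; have := r_swap i' k' k' i'.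
  have := r_swap l' j' j' l'; have := r_swap l' j' k' l'.
  have := r_swap l' k' j' l'; have := r_swap l' k' k' l'.
  have := r_rev l' j' j' i'; have := r_rev l' k' j' i'.
  have := r_rev l' j' k' i'; have := r_rev l' k' k' i'.
  by rewrite !ler_norml; lra.
move: (Q3 i l j k) (Q3 j l k i); have := rB i j k l; have := r12 k i j l.
have := r12 j i k l; rewrite !ler_norml; lra.
Qed.
End Polarization.

Definition ric j k : R := \sum_i r i j k i.
Definition scal : R := \sum_i \sum_j r i j j i.
(** Minus twice the Einstein tensor, formed with Euclidean contractions. *)
Definition einst j k : R := scal * (j == k)%:R - 2 * ric j k.

Definition einst_form u : R := \sum_j \sum_k u 0 j * einst j k * u 0 k.

Let del (i j : 'I_n) : R := (i == j)%:R.

Lemma sum_del (F : 'I_n -> R) i : \sum_j del i j * F j = F i.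
Proof.
rewrite (bigD1 i) //= /del eqxx mul1r big1 ?addr0 // => j /negPf ji.
by rewrite eq_sym ji mul0r.
Qed.

Lemma einst_formE u :
  einst_form u = scal * dot u u - 2 * \sum_j \sum_k u 0 j * ric j k * u 0 k.
Proof.
rewrite dotE [scal * _]mulr_sumr [2 * _]mulr_sumr -sumrB.
apply: eq_bigr => j _.
transitivity (\sum_k (scal * (del j k * (u 0 j * u 0 k)) - 2 * (u 0 j * ric j k * u 0 k))).
  by apply: eq_bigr => k _; rewrite /einst /del; ring.
by rewrite sumrB -!mulr_sumr sum_del.
Qed.

(* [dot u u] times the projection of the a-th basis vector orthogonally to u. *)
Definition shadow u (a : 'I_n) : 'rV[R]_n := dot u u *: delta_mx 0 a - u 0 a *: u.

Lemma shadowE u a i : shadow u a 0 i = dot u u * del a i - u 0 a * u 0 i.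
Proof. by rewrite !mxE eqxx /= eq_sym. Qed.

(** The shadows are the rows of P = |u|^2 I - u u^T, which is |u|^2 times a projection: P P^T =
    |u|^2 P. *)
Lemma sum_shadow u i l :
  \sum_a shadow u a 0 i * shadow u a 0 l =
  dot u u * (dot u u * del i l - u 0 i * u 0 l).
Proof.
set s := dot u u.
transitivity (\sum_a (s ^+ 2 * (del i a * del a l) - s * u 0 l * (del i a * u 0 a)
   - s * u 0 i * (del l a * u 0 a) + u 0 i * u 0 l * (u 0 a * u 0 a))).
  apply: eq_bigr => a _; rewrite !shadowE -/s /del (eq_sym a i) (eq_sym l a).
  by case: (i == a); case: (a == l) => /=; ring.
rewrite big_split sumrB sumrB /= -!mulr_sumr !sum_del -dotE -/s; ring.
Qed.

(** Summing over both shadows contracts the index pairs (i, l) and (j, k) of [r] with P. Expanding P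
    gives [scal] from the two identity parts ([E1]), the Ricci form from each mixed product ([E2],
    [E3]), and r(u, u, u, u) = 0 ([E4]). *)
Lemma sum_quad_shadow u :
  \sum_a \sum_b quad (shadow u a) (shadow u b) = dot u u ^+ 3 * einst_form u.
Proof.
set s := dot u u.
pose h i l := s * del i l - u 0 i * u 0 l.
have -> : \sum_a \sum_b quad (shadow u a) (shadow u b) =
  \sum_(p : 'I_n * 'I_n * 'I_n * 'I_n) s ^+ 2 * (h p.1.1.1 p.2 * h p.1.1.2 p.1.2) *
     r p.1.1.1 p.1.1.2 p.1.2 p.2.
  rewrite /quad /form4; under eq_bigr do rewrite exchange_big /=.
  rewrite exchange_big /=; apply: eq_bigr => p _.
  have -> : s ^+ 2 * (h p.1.1.1 p.2 * h p.1.1.2 p.1.2) =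
     (s * h p.1.1.1 p.2) * (s * h p.1.1.2 p.1.2) by ring.
  rewrite -!sum_shadow big_distrlr /= mulr_suml; apply: eq_bigr => a _.
  by rewrite mulr_suml; apply: eq_bigr => b _; ring.
rewrite sum4E /= einst_formE -/s.
have E1 : \sum_i \sum_j \sum_k \sum_l del i l * (del j k * r i j k l) = scal.
  apply: eq_bigr => i _; apply: eq_bigr => j _.
  under eq_bigr do rewrite sum_del.
  by rewrite sum_del.
have E2 : \sum_i \sum_j \sum_k \sum_l del i l * (u 0 j * u 0 k * r i j k l) =
    \sum_j \sum_k u 0 j * ric j k * u 0 k.
  rewrite exchange_big /=; apply: eq_bigr => j _.
  rewrite exchange_big /=; apply: eq_bigr => k _.
  rewrite /ric mulr_sumr mulr_suml; apply: eq_bigr => i _.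
  by rewrite sum_del; ring.
have E3 : \sum_i \sum_j \sum_k \sum_l del j k * (u 0 i * u 0 l * r i j k l) =
    \sum_j \sum_k u 0 j * ric j k * u 0 k.
  apply: eq_bigr => i _.
  under eq_bigr do rewrite exchange_big /=.
  rewrite exchange_big /=; apply: eq_bigr => l _.
  under eq_bigr do rewrite sum_del.
  rewrite /ric mulr_sumr mulr_suml; apply: eq_bigr => j _.
  by rewrite (r_swap i j); ring.
have E4 : \sum_i \sum_j \sum_k \sum_l u 0 i * u 0 j * u 0 k * u 0 l * r i j k l = 0.
  have := form4_swap12 u u u u.
  rewrite /form4 sum4E /=; lra.
transitivity (s ^+ 4 * (\sum_i \sum_j \sum_k \sum_l del i l * (del j k * r i j k l))
  - s ^+ 3 * (\sum_i \sum_j \sum_k \sum_l del i l * (u 0 j * u 0 k * r i j k l))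
  - s ^+ 3 * (\sum_i \sum_j \sum_k \sum_l del j k * (u 0 i * u 0 l * r i j k l))
  + s ^+ 2 * \sum_i \sum_j \sum_k \sum_l u 0 i * u 0 j * u 0 k * u 0 l * r i j k l); last first.
  by rewrite E1 E2 E3 E4; ring.
rewrite !mulr_sumr -!sumrB -big_split; apply: eq_bigr => i _ /=.
rewrite !mulr_sumr -!sumrB -big_split; apply: eq_bigr => j _ /=.
rewrite !mulr_sumr -!sumrB -big_split; apply: eq_bigr => k _ /=.
rewrite !mulr_sumr -!sumrB -big_split; apply: eq_bigr => l _ /=.
rewrite /h; ring.
Qed.

End Symmetries.

Lemma dot_shadow u a b : dot (shadow u a) (shadow u b) =
  dot u u * (dot u u * (a == b)%:R - u 0 a * u 0 b).
Proof.
rewrite /shadow /dot !(bilDl, bilDr, bilNl, bilNr, bilZl, bilZr) -!/(dot _ _).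
have d c : dot u (delta_mx 0 c) = u 0 c.
  rewrite dotE (bigD1 c) //= mxE !eqxx mulr1 big1 ?addr0 // => i /negPf ic.
  by rewrite mxE ic andbF mulr0.
by rewrite (dotC (delta_mx 0 a) u) !d /dot bil_delta mxE; ring.
Qed.

(** Apart from the scaling, this counts the ordered pairs of distinct vectors in an orthonormal
    basis of the complement of u, of dimension n - 1. *)
Lemma sum_area_shadow u : \sum_a \sum_b area 1%:M (shadow u a) (shadow u b) =
  dot u u ^+ 4 * ((n%:R - 1) * (n%:R - 2)).
Proof.
set s := dot u u.
have sd a (F : 'I_n -> R) : \sum_b (a == b)%:R * F b = F a.
  rewrite (bigD1 a) //= eqxx mul1r big1 ?addr0 // => j /negPf ja.
  by rewrite eq_sym ja mul0r.
transitivity (\sum_a \sum_b (s ^+ 2 * ((s - u 0 a * u 0 a) * (s - u 0 b * u 0 b)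
   - (a == b)%:R * (s ^+ 2 - 2 * s * (u 0 a * u 0 b))
   - u 0 a * u 0 a * (u 0 b * u 0 b)))).
  apply: eq_bigr => a _; apply: eq_bigr => b _.
  rewrite /area -!/(dot _ _) !dot_shadow -/s !eqxx.
  by case: eqP => [->|_] /=; ring.
have S1 : \sum_a (s - u 0 a * u 0 a) = s * n%:R - s.
  by rewrite sumrB -dotE -/s sumr_const card_ord mulr_natr.
transitivity (\sum_a (s ^+ 2 * ((s - u 0 a * u 0 a) * (s * n%:R - s)
   - (s ^+ 2 - 2 * s * (u 0 a * u 0 a)) - u 0 a * u 0 a * s))).
  apply: eq_bigr => a _; rewrite -mulr_sumr !sumrB sd -!mulr_sumr S1.
  by rewrite -dotE.
rewrite -mulr_sumr !sumrB -!mulr_suml S1 -mulr_sumr -dotE -/s sumr_const card_ord -mulr_natr.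
ring.
Qed.

End Form4.

(** * Consequences of pinching at one point *)

Section Pinching.
Context {R : realFieldType} {n : nat}.
Variables (r : 'I_n -> 'I_n -> 'I_n -> 'I_n -> R) (A : 'M[R]_n).
Hypothesis r12 : forall i j k l, r i j k l = - r j i k l.
Hypothesis r34 : forall i j k l, r i j k l = - r i j l k.
Hypothesis rB : forall i j k l, r i j k l + r j k i l + r k i j l = 0.
Hypothesis sA : A^T = A.
Hypothesis pA : forall v, v != 0 -> 0 < bil A v v.

Lemma free_delta (i j : 'I_n) : i != j ->
  row_free (col_mx (delta_mx 0 i) (delta_mx 0 j) : 'M[R]_(1 + 1, n)).
Proof.
move=> /negPf ij; apply: (@area_gt0_free _ _ 1%:M).
by rewrite /area !bil_delta !mxE !eqxx ij expr0n subr0 mulr1.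
Qed.

Lemma scal_le0 : (forall u v, row_free (col_mx u v) -> quad r u v <= 0) ->
  scal r <= 0.
Proof.
move=> q0; apply: sumr_le0 => i _; apply: sumr_le0 => j _.
have [->|/free_delta/q0] := eqVneq i j; last by rewrite quad_delta.
by have := r12 j j j j; lra.
Qed.

(** Once the denominator is cleared, dependent pairs may be included: all three terms vanish
    there. *)
Lemma pinching_all (a b : R) :
  (forall u v, row_free (col_mx u v) -> a <= quad r u v / area A u v <= b) ->
  forall u v, a * area A u v <= quad r u v <= b * area A u v.
Proof.
move=> H u v; have [->|[t ->]|a0] := perp_cases sA pA u v.
- by rewrite area0l -(scale0r v) !mulr0 /quad form4_swap12 // form4Z2 mul0r oppr0 lexx.
- by rewrite area_scale !mulr0 /quad form4_collinear // lexx.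
- have /andP[] := H u v (area_gt0_free a0).
  by rewrite ler_pdivlMr // ler_pdivrMr // => -> ->.
Qed.

Variables (lam Lam del kap : R).
Hypothesis n3 : (3 <= n)%N.
Hypothesis lam0 : 0 < lam.
Hypothesis Lam0 : 0 < Lam.
Hypothesis del0 : 0 < del.
Hypothesis kap0 : 0 < kap.
Hypothesis lamA : forall v, lam * dot v v <= bil A v v.
Hypothesis LamA : forall i j, A i j <= Lam.
Hypothesis pinch : forall u v,
  del * kap * area A u v <= quad r u v <= kap * area A u v.

Lemma quad_lower u v : del * kap * lam ^+ 2 * area 1%:M u v <= quad r u v.
Proof.
have /andP[+ _] := pinch u v; apply: le_trans.
rewrite -mulrA; apply: ler_wpM2l; first by rewrite mulr_ge0 ?ltW.
by apply: area_lower => //; exact: ltW.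
Qed.

Lemma quad_upper u v a b : bil A u u <= a -> bil A v v <= b ->
  `|quad r u v| <= kap * (a * b).
Proof.
move=> ua vb; have /andP[q1 q2] := pinch u v.
have dk : 0 <= del * kap by rewrite mulr_ge0 ?ltW.
rewrite ger0_norm; last by apply: le_trans q1; rewrite mulr_ge0 ?area_ge0.
apply: le_trans q2 _; apply: ler_wpM2l; first exact: ltW.
by apply: le_trans (area_le A u v) _; apply: ler_pM; rewrite ?bil_ge0.
Qed.

(** All diagonal terms are nonnegative, so one coordinate plane of Euclidean area 1 suffices. With
    [scal_upper] this makes [scal r] comparable with [kap], which the final bounds must avoid since
    [kap] may be arbitrarily small. *)
Lemma scal_lower : del * kap * lam ^+ 2 <= scal r.
Proof.
have q0 i j : 0 <= r i j j i.
  rewrite -quad_delta; have /andP[+ _] := pinch (delta_mx 0 i) (delta_mx 0 j).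
  have dk : 0 <= del * kap by rewrite mulr_ge0 ?ltW.
  by apply: le_trans; rewrite mulr_ge0 ?area_ge0.
pose i0 : 'I_n := Ordinal (ltn_trans (isT : (0 < 2)%N) n3).
pose i1 : 'I_n := Ordinal (ltn_trans (isT : (1 < 2)%N) n3).
rewrite /scal (bigD1 i0) //= (bigD1 i1) //=.
have := quad_lower (delta_mx 0 i0) (delta_mx 0 i1).
rewrite quad_delta /area !bil_delta !mxE !eqxx /= expr0n subr0 !mulr1 => h.
have h1 : 0 <= \sum_(j | j != i1) r i0 j j i0 by apply: sumr_ge0.
have h2 : 0 <= \sum_(i | i != i0) \sum_j r i j j i.
  by apply: sumr_ge0 => i _; apply: sumr_ge0.
lra.
Qed.

Lemma scal_gt0 : 0 < scal r.
Proof. by apply: lt_le_trans scal_lower; rewrite !mulr_gt0 ?exprn_gt0. Qed.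

(** Here 48 = 3 * 4^2: polarization costs 3, and a sum of two basis vectors has squared A-norm at
    most 4 [Lam]. *)
Lemma r_bound i j k l :
  `|r i j k l| <= 48 * Lam ^+ 2 / (del * lam ^+ 2) * scal r.
Proof.
have b2 a b : bil A (delta_mx 0 a + delta_mx 0 b) (delta_mx 0 a + delta_mx 0 b) <= 4 * Lam.
  rewrite !(bilDl, bilDr) !bil_delta.
  by move: (LamA a a) (LamA a b) (LamA b a) (LamA b b); lra.
have b1 a : bil A (delta_mx 0 a) (delta_mx 0 a) <= 4 * Lam.
  by rewrite bil_delta; move: (LamA a a) Lam0; lra.
have P := @polarization _ _ r r12 r34 rB (kap * (4 * Lam * (4 * Lam))).
apply: le_trans (P _ _ _ i j k l) _.
- by move=> a b; rewrite -quad_delta; apply: quad_upper.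
- by move=> a b c; apply: quad_upper.
- by move=> a b c d; apply: quad_upper.
have -> : 3 * (kap * (4 * Lam * (4 * Lam))) =
  48 * Lam ^+ 2 / (del * lam ^+ 2) * (del * kap * lam ^+ 2).
  by field; rewrite !gt_eqF.
apply: ler_wpM2l scal_lower.
by rewrite divr_ge0 ?mulr_ge0 ?exprn_ge0 ?(ltW lam0) ?(ltW del0) ?(ltW Lam0).
Qed.

Lemma scal_upper : scal r <= n%:R ^+ 2 * (kap * (Lam * Lam)).
Proof.
have q i j : r i j j i <= kap * (Lam * Lam).
  rewrite -quad_delta; apply: le_trans (ler_norm _) _.
  by apply: quad_upper; rewrite bil_delta.
apply: (@le_trans _ _ (\sum_(i < n) \sum_(j < n) kap * (Lam * Lam))).
  by apply: ler_sum => i _; apply: ler_sum => j _.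
by rewrite !sumr_const !card_ord -mulrnA -[leLHS]mulr_natl natrM -expr2.
Qed.

Lemma einst_lower u :
  del * lam ^+ 2 / (n%:R ^+ 2 * Lam ^+ 2) * scal r * dot u u <= einst_form r u.
Proof.
have [->|u0] := eqVneq u 0.
  by rewrite /dot bil0l mulr0 /einst_form big1 // => i _; rewrite big1 // => j _; rewrite mxE !mul0r.
have s0 := dot_gt0 u0; set s := dot u u in s0 *.
have n0 : 0 < n%:R :> R by rewrite ltr0n (leq_trans _ n3).
(* This product is the total area in [sum_area_shadow]; it is zero in dimension 2. *)
have N1 : 1 <= (n%:R - 1) * (n%:R - 2) :> R.
  have n3' : 3 <= n%:R :> R by rewrite ler_nat.
  have -> : 1 = 1 * 1 :> R by rewrite mulr1.
  by apply: ler_pM => //; lra.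
have L : del * kap * lam ^+ 2 * s <= einst_form r u.
  rewrite -(ler_pM2l (exprn_gt0 3 s0)) -(sum_quad_shadow r12 r34).
  apply: (@le_trans _ _ (\sum_a \sum_b
     del * kap * lam ^+ 2 * area 1%:M (shadow u a) (shadow u b))); last first.
    by apply: ler_sum => a _; apply: ler_sum => b _; exact: quad_lower.
  under eq_bigr do rewrite -mulr_sumr.
  rewrite -mulr_sumr sum_area_shadow -/s.
  have -> : s ^+ 3 * (del * kap * lam ^+ 2 * s) = del * kap * lam ^+ 2 * (s ^+ 4 * 1) by ring.
  apply: ler_wpM2l.
    by rewrite !mulr_ge0 ?exprn_ge0 ?(ltW lam0) ?(ltW del0) ?(ltW kap0).
  by apply: ler_wpM2l; rewrite ?exprn_ge0 // ltW.
apply: le_trans L; apply: ler_wpM2r; first exact: ltW.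
apply: (@le_trans _ _ (del * lam ^+ 2 / (n%:R ^+ 2 * Lam ^+ 2) * (n%:R ^+ 2 * (kap * (Lam * Lam))))).
  apply: ler_wpM2l scal_upper.
  by rewrite divr_ge0 ?mulr_ge0 ?exprn_ge0 ?(ltW lam0) ?(ltW del0) ?(ltW Lam0) ?(ltW n0).
by rewrite le_eqVlt; apply/orP; left; apply/eqP; field; rewrite !gt_eqF.
Qed.

End Pinching.

(** * Sums over grids *)

(** Only x is confined to [K]: continuity at its points is in the whole space, so y may lie outside.
    The radius comes from the near-covering form of compactness. *)
Lemma compact_uniform_continuity (R : realType) (V : normedModType R)
    (f : V -> R) (K : set V) (e : R) :
  compact K -> (forall x, K x -> {for x, continuous f}) -> 0 < e ->
  exists2 d : R, 0 < d & forall x y, K x -> `|x - y| < d -> `|f x - f y| < e.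
Proof.
move=> cK cf e0; have e2 : 0 < e / 2 by rewrite divr_gt0.
pose P (d : R) (x : V) := forall y, `|x - y| < d -> `|f x - f y| < e.
have : \forall d \near (0 : R)^'+, K `<=` P d.
  apply: (compact_near_coveringP K).1 => // x Kx.
  have [d d0 fd] := continuous_normP (cf x Kx) e2.
  have d2 : 0 < d / 2 by rewrite divr_gt0.
  exists ([set y | `|x - y| < d / 2], [set t | t < d / 2]).
    split; last exact: nbhs_right_lt.
    by apply/nbhs_normP; exists (d / 2).
  move=> -[y t] [/= xy td] z yz.
  have xz : `|x - z| < d.
    apply: le_lt_trans (ler_distD y x z) _; rewrite (splitr d).
    by apply: ltrD => //; exact: lt_trans td.
  have xy' : `|x - y| < d by apply: lt_trans xy _; lra.
  apply: le_lt_trans (ler_distD (f x) (f y) (f z)) _.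
  by rewrite (splitr e) (distrC (f y)) ltrD // fd.
move=> H; have H0 : \forall d \near (0 : R)^'+, 0 < d by exact: nbhs_right_gt.
have [d [Kd d0]] := @filter_ex R (at_right (0 : R)) _ _ (filterI H H0).
by exists d => // x y Kx; exact: Kd.
Qed.

Section Grid.
Context {R : realType} {n : nat}.
Implicit Types (x y q : 'rV[R]_n) (i : 'I_n).

Lemma rV_norm_leP x (l : R) : 0 <= l ->
  reflect (forall i, `|x 0 i| <= l) (`|x| <= l).
Proof.
move=> l0; rewrite [`|x|]/Num.Def.normr /= mx_normrE.
apply: (iffP (bigmax_leP _ _ _ _)) => [[_ H] i|H]; first exact: (H (0, i)).
by split => // -[a i] _ /=; rewrite ord1.
Qed.

Lemma rV_norm_coord x i : `|x 0 i| <= `|x|.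
Proof. exact/rV_norm_leP. Qed.

(** The norm on rows is the sup norm, so this is a closed cube with faces parallel to the axes. *)
Definition box q (l : R) : set 'rV[R]_n := [set x | `|q - x| <= l].

Lemma box_compact q l : compact (box q l).
Proof.
apply: bounded_closed_compact; last exact: closed_closed_ball_.
exists (`|q| + l); split; first exact: num_real.
move=> M qM x /= xq; apply: le_trans (ltW qM).
have -> : x = q - (q - x) by rewrite subKr.
by apply: le_trans (ler_normB _ _) _; rewrite lerD2l.
Qed.

Variables (q : 'rV[R]_n) (l : R).
Hypothesis l0 : 0 < l.

Lemma boxP x : box q l x <-> forall i, `|q 0 i - x 0 i| <= l.
Proof.
split=> [/(rV_norm_leP _ (ltW l0)) H i|H]; first by have := H i; rewrite !mxE.
by apply/(rV_norm_leP _ (ltW l0)) => i; rewrite !mxE.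
Qed.

Definition mesh (N : nat) : R := 2 * l / N%:R.

Definition grid (N : nat) := {ffun 'I_n -> 'I_N}.

(** The lower corner of cell [k]; no node lies on an upper face. *)
Definition node N (k : grid N) : 'rV[R]_n :=
  \row_i (q 0 i - l + mesh N * (k i)%:R).

Definition step N i (k : grid N) : grid N :=
  [ffun j => if j == i then ordS (k j) else k j].

Lemma step_inj N i : injective (step (N := N) i).
Proof.
move=> k k' /ffunP E; apply/ffunP => j; have := E j; rewrite !ffunE.
by case: eqP => // _ /ordS_inj.
Qed.

Lemma mesh_ge0 N : 0 <= mesh N.
Proof. by rewrite divr_ge0 ?mulr_ge0 ?ler0n ?(ltW l0). Qed.

Lemma node_stepE N i (k : grid N) t : 0 <= t <= mesh N ->
  box q l (node k + t *: delta_mx 0 i).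
Proof.
move=> /andP[t0 tN]; apply/boxP => j; rewrite !mxE eqxx /=.
have N0 : (0 < N)%N by exact: leq_ltn_trans (leq0n _) (ltn_ord (k j)).
have m1 : mesh N * (k j).+1%:R <= 2 * l.
  rewrite /mesh -mulrA ler_piMr ?mulr_ge0 ?(ltW l0) // mulrC ler_pdivrMr ?ltr0n //.
  by rewrite mul1r ler_nat.
rewrite -natr1 mulrDr mulr1 in m1.
have m2 : 0 <= mesh N * (k j)%:R by rewrite mulr_ge0 ?mesh_ge0.
rewrite ler_norml; case: eqP => _; rewrite ?mulr1 ?mulr0; apply/andP; split; lra.
Qed.

Lemma node_box N (k : grid N) : box q l (node k).
Proof.
have [i _|n0] := pickP 'I_n.
  have t0 : (0 : R) <= 0 <= mesh N by rewrite lexx mesh_ge0.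
  by have := node_stepE i k t0; rewrite scale0r addr0.
by apply/boxP => i; have := n0 i.
Qed.

(* Telescoping along the i-th axis, made cyclic: f vanishes on both opposite
   faces, so the last node may be shifted back to the first one. *)
Lemma telescope_axis N i (f : 'rV[R]_n -> R) :
  (forall x, box q l x -> `|q 0 i - x 0 i| = l -> f x = 0) ->
  \sum_(k : grid N) (f (node k + mesh N *: delta_mx 0 i) - f (node k)) = 0.
Proof.
move=> f0.
have E (k : grid N) : f (node k + mesh N *: delta_mx 0 i) = f (node (step i k)).
  have N0 : (0 < N)%N by exact: leq_ltn_trans (leq0n _) (ltn_ord (k i)).
  have NR : (N%:R : R) != 0 by rewrite pnatr_eq0 -lt0n.
  have [kN|kN] := ltnP (k i).+1 N.
    congr f; apply/rowP => j; rewrite !mxE ffunE eqxx /=.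
    case: eqP => [->|_] /=; last by rewrite mulr0 addr0.
    by rewrite modn_small // -natr1; ring.
  have kiN : (k i).+1 = N by apply/eqP; rewrite eqn_leq kN ltn_ord.
  have lE : mesh N * N%:R = 2 * l by rewrite /mesh divfK.
  rewrite !f0 //.
  - exact: node_box.
  - rewrite !mxE ffunE eqxx /= kiN modnn mulr0 addr0 subKr gtr0_norm //.
  - by apply: node_stepE; rewrite mesh_ge0 lexx.
  - have kR : (k i)%:R + 1 = N%:R :> R by rewrite natr1 kiN.
    have mk : mesh N * (k i)%:R + mesh N = 2 * l by rewrite -lE -kR; ring.
    rewrite !mxE !eqxx mulr1.
    have -> : q 0 i - (q 0 i - l + mesh N * (k i)%:R + mesh N) = - l by lra.
    by rewrite normrN gtr0_norm.
under eq_bigr do rewrite E.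
by rewrite sumrB [X in _ - X](reindex_inj (@step_inj N i)) subrr.
Qed.

(** * The divergence theorem on grids *)

Section Flux.
Variable V : 'I_n -> 'rV[R]_n -> R.
Hypothesis V_derivable : forall i x, box q l x -> derivable (V i) x (delta_mx 0 i).
Hypothesis dV_continuous :
  forall i x, box q l x -> {for x, continuous (partial i (V i))}.
Hypothesis V_face : forall i x, box q l x -> `|q 0 i - x 0 i| = l -> V i x = 0.

Definition divergence x := \sum_i partial i (V i) x.

Lemma uniform_dV (e : R) : 0 < e -> exists2 d : R, 0 < d &
  forall i x y, box q l x -> `|x - y| < d ->
    `|partial i (V i) x - partial i (V i) y| < e.
Proof.
move=> e0.
have /choice[d dP] i : exists d : R, 0 < d /\ forall x y, box q l x ->
    `|x - y| < d -> `|partial i (V i) x - partial i (V i) y| < e.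
  have [d d0 dP] := compact_uniform_continuity (@box_compact q l) (@dV_continuous i) e0.
  by exists d.
exists (\big[Num.min/1]_i d i).
  by apply/bigmin_gtP; split => // i _; have [] := dP i.
move=> i x y bx xy; have [_] := dP i; apply => //.
by apply: lt_le_trans xy _; exact: bigmin_le_cond.
Qed.

(** By the mean value theorem each edge increment of [V i] is the mesh times a value of
    [partial i (V i)] within [e'] of the one at the node, and the increments along each axis
    telescope to 0. *)
Lemma divergence_sum_le (e : R) : 0 < e -> exists N0 : nat, forall N, (N0 < N)%N ->
  \sum_(k : grid N) divergence (node k) <= e * N%:R ^+ n.
Proof.
(* The n axes together contribute n * e' <= e; the successor avoids division by zero. *)
move=> e0; pose e' := e / n.+1%:R.
have e'0 : 0 < e' by rewrite divr_gt0.
have [d d0 dP] := uniform_dV e'0.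
exists (Num.bound (2 * l / d)) => N NN.
have N0 : (0 < N)%N by apply: leq_ltn_trans NN.
have NR : 0 < N%:R :> R by rewrite ltr0n.
have m0 : 0 < mesh N by rewrite /mesh divr_gt0 ?mulr_gt0.
have md : mesh N < d.
  rewrite /mesh ltr_pdivrMr // [ltRHS]mulrC -ltr_pdivrMr //.
  have B0 : 0 <= 2 * l / d by rewrite divr_ge0 ?mulr_ge0 ?(ltW l0) ?(ltW d0).
  by apply: lt_trans (archi_boundP B0) _; rewrite ltr_nat.
have cmp i (k : grid N) : mesh N * (partial i (V i) (node k) - e') <=
    V i (node k + mesh N *: delta_mx 0 i) - V i (node k).
  have [t tN ->] := MVT_line (f := V i) (ltW m0)
    (fun t th => V_derivable (node_stepE i k th)).
  rewrite ler_pM2l // lerBlDr -lerBlDl -/(partial i _ _).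
  have bk := node_box k.
  apply: le_trans (ler_norm _) _; apply: ltW; apply: dP => //.
  rewrite opprD addNKr normrN normrZ; case/andP: tN => t0 tN.
  rewrite ger0_norm //; apply: le_lt_trans md; apply: le_trans tN.
  by rewrite ler_piMr // norm_delta_mx.
have H : \sum_i \sum_(k : grid N) mesh N * (partial i (V i) (node k) - e') <= 0.
  apply: sumr_le0 => i _; rewrite -[leRHS](telescope_axis N (V_face (i := i))).
  by apply: ler_sum => k _; exact: cmp.
have {H} : \sum_i \sum_(k : grid N) (partial i (V i) (node k) - e') <= 0.
  move: H; under eq_bigr do rewrite -mulr_sumr.
  by rewrite -mulr_sumr pmulr_rle0.
rewrite exchange_big /=; under eq_bigr do rewrite sumrB sumr_const card_ord.
rewrite sumrB sumr_const card_ffun !card_ord subr_le0 => /le_trans; apply.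
rewrite -[leLHS]mulr_natr natrX; apply: ler_wpM2r.
  by rewrite exprn_ge0 // ltW.
by rewrite -mulr_natl /e' mulrCA ler_piMr ?(ltW e0) // ler_pdivrMr ?ltr0n // mul1r ler_nat.
Qed.

(* A box around an interior point contains a fixed proportion of the nodes of
   every sufficiently divisible grid. *)
Lemma divergence_average (x0 : 'rV[R]_n) (rho m M : R) :
  `|q - x0| < l -> 0 < rho -> 0 <= M ->
  (forall x, box q l x -> - m <= divergence x) ->
  (forall x, box q l x -> `|x0 - x| <= rho -> M - m <= divergence x) ->
  M / (Num.bound (2 * l / rho)).+1%:R ^+ n <= m.
Proof.
move=> qx0 rho0 M0 lower good.
(* A coarse grid with [K] cells per axis has cells of side at most [rho]. *)
set K := (Num.bound _).+1.
have B0 : 0 <= 2 * l / rho by rewrite divr_ge0 ?mulr_ge0 ?(ltW l0) ?(ltW rho0).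
have K0 : 0 < K%:R :> R by rewrite ltr0n.
have Krho : 2 * l / K%:R <= rho.
  rewrite ler_pdivrMr // [leRHS]mulrC -ler_pdivrMr //.
  by apply: ltW; apply: lt_trans (archi_boundP B0) _; rewrite ltr_nat.
pose y i := (x0 0 i - (q 0 i - l)) / (2 * l) * K%:R.
have l2 : 0 < 2 * l by rewrite mulr_gt0.
have yi i : 0 <= y i < K%:R.
  have := le_lt_trans (rV_norm_coord (q - x0) i) qx0.
  rewrite !mxE ltr_norml => /andP[h1 h2].
  apply/andP; split; first by rewrite mulr_ge0 ?divr_ge0 ?(ltW l2) //; lra.
  by rewrite gtr_pMl // ltr_pdivrMr // mul1r; lra.
(* The coarse cell that contains [x0]; [y] is the position measured in coarse cells. *)
pose c i := Num.truncn (y i).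
have cK i : (c i < K)%N.
  have /andP[y0 yK] := yi i; have /andP[c1 _] := truncn_itv y0.
  by rewrite -(ltr_nat R); apply: le_lt_trans c1 yK.
apply/ler_addgt0Pr => e e0.
have [N0 HN] := divergence_sum_le e0.
(* As [N] is a multiple of [K], the coarse cell of [x0] is a block of p^n nodes of the fine grid,
   embedded by [sub]. *)
pose p := N0.+1; pose N := (K * p)%N.
have p0 : 0 < p%:R :> R by rewrite ltr0n.
have NR : N%:R = K%:R * p%:R :> R by rewrite natrM.
have subK (g : {ffun 'I_n -> 'I_p}) i : (c i * p + g i < N)%N.
  apply: (@leq_trans (c i * p + p)); first by rewrite ltn_add2l.
  by rewrite -mulSnr leq_mul2r cK orbT.
pose sub (g : {ffun 'I_n -> 'I_p}) : grid N := [ffun i => Ordinal (subK g i)].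
have sub_inj : injective sub.
  move=> g h /ffunP E; apply/ffunP => i; apply: val_inj.
  by have := congr1 val (E i); rewrite !ffunE /= => /addnI.
have near_x0 g : `|x0 - node (sub g)| <= rho.
  apply/(rV_norm_leP _ (ltW rho0)) => i; rewrite !mxE ffunE /=.
  have /andP[y0 yK] := yi i; have /andP[c1 c2] := truncn_itv y0.
  rewrite -/(c i) -natr1 in c1 c2.
  have -> : x0 0 i - (q 0 i - l + mesh N * (c i * p + g i)%N%:R) =
      2 * l / K%:R * (y i - ((c i)%:R + (g i)%:R / p%:R)).
    rewrite /mesh NR natrD natrM /y.
    by field; rewrite (gt_eqF p0) (gt_eqF K0) (gt_eqF l0).
  have g0 : 0 <= (g i)%:R / p%:R :> R by rewrite divr_ge0.
  have g1 : (g i)%:R / p%:R <= 1 :> R.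
    by rewrite ler_pdivrMr // mul1r ler_nat ltnW.
  rewrite normrM ger0_norm; last by rewrite divr_ge0 ?(ltW l2) ?(ltW K0).
  apply: le_trans Krho; rewrite ler_piMr ?divr_ge0 ?(ltW l2) ?(ltW K0) //.
  by rewrite ler_norml; apply/andP; split; lra.
have count : M * p%:R ^+ n - m * N%:R ^+ n <= \sum_(k : grid N) divergence (node k).
  apply: (@le_trans _ _ (\sum_(k : grid N) ((k \in sub @: {ffun 'I_n -> 'I_p})%:R * M - m))).
    rewrite sumrB -mulr_suml sumr_const card_ffun !card_ord.
    have -> : \sum_(k : grid N) ((k \in sub @: {ffun 'I_n -> 'I_p})%:R : R) = p%:R ^+ n.
      rewrite -natr_sum -natrX; congr (_%:R).
      transitivity #|sub @: {ffun 'I_n -> 'I_p}|.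
        by rewrite -sum1_card [RHS]big_mkcond; apply: eq_bigr => k _; case: (k \in _).
      by rewrite card_imset // card_ffun !card_ord.
    by rewrite mulrC -[m *+ _]mulr_natr natrX.
  apply: ler_sum => k _; case: imsetP => [[g _ ->]|_]; rewrite ?mul1r ?mul0r ?sub0r.
    by apply: good; [exact: node_box|exact: near_x0].
  by apply: lower; exact: node_box.
have HNN := HN N (ltac:(rewrite /N /p mulSn; exact: leq_addr)).
have E := le_trans count HNN.
rewrite ler_pdivrMr ?exprn_gt0 //.
rewrite -(ler_pM2r (exprn_gt0 n p0)).
by move: E; rewrite NR exprMn; lra.
Qed.

End Flux.

End Grid.

(** * The cutoff *)

Section Cutoff.
Context {R : realType}.
Implicit Types (s t eta : R).

Definition pos t : R := (t + `|t|) / 2.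

Lemma pos_ge t : 0 <= t -> pos t = t.
Proof. by move=> t0; rewrite /pos ger0_norm //; field. Qed.

Lemma pos_le t : t <= 0 -> pos t = 0.
Proof. by move=> t0; rewrite /pos ler0_norm // subrr mul0r. Qed.

Lemma pos_continuous : continuous pos.
Proof.
move=> t; apply: (@continuousM _ _ (fun t : R => t + `|t|) (fun=> 2^-1)).
  by apply: (@continuousD _ _ _ id (fun t : R => `|t|)); [exact: cvg_id | exact: norm_continuous].
exact: cst_continuous.
Qed.

(** Squaring makes the positive part C^1, as both cutoff factors must be. *)
Definition possq t : R := pos t ^+ 2.

Lemma is_derive_possq t : is_derive t 1 possq (2 * pos t).
Proof.
have [t0|t0|->] := ltgtP t 0.
- have E : \forall s \near t, cst 0 s = possq s.
    near=> s; rewrite /possq pos_le ?expr0n //.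
    by apply: ltW; near: s; exact: lt_nbhsl.
  by rewrite pos_le ?(ltW t0) // mulr0; apply: near_eq_is_derive E _.
- have E : \forall s \near t, (fun s => s ^+ 2) s = possq s.
    near=> s; rewrite /possq pos_ge //.
    by apply: ltW; near: s; exact: lt_nbhsr.
  rewrite pos_ge ?(ltW t0) //; apply: near_eq_is_derive E _.
  by apply: is_derive_eq; rewrite /GRing.scale /= mulr1 mulr_natl.
- have E : (fun h : R => h^-1 *: (possq (h *: 1 + 0) - possq 0)) = pos.
    apply/funext => h; rewrite /possq (pos_le (lexx 0)) expr0n subr0 addr0.
    rewrite /GRing.scale /= mulr1; have [h0|h0] := leP 0 h.
      rewrite pos_ge //; have [->|hn] := eqVneq h 0; first by rewrite expr0n mulr0.
      by rewrite expr2 mulKf.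
    by rewrite pos_le ?(ltW h0) // expr0n mulr0.
  have C : pos @ 0^' --> 2 * pos 0.
    rewrite (pos_le (lexx 0)) mulr0 -[X in _ --> X](pos_le (lexx 0)).
    by apply: cvg_within_filter; exact: pos_continuous.
  split; first by rewrite /derivable /= E; apply/cvg_ex; exists (2 * pos 0).
  by rewrite /derive /= E; apply/cvg_lim.
Unshelve. all: by end_near. Qed.

Definition logcut eta s : R := possq (ln (s / eta)).

Definition dlogcut eta s : R := 2 * pos (ln (s / eta)) / s.

(** Nonpositive s are included: [ln] takes the value 0 there by convention, so the positive part
    still vanishes. *)
Lemma logcut_le eta s : 0 < eta -> s <= eta -> logcut eta s = 0 /\ dlogcut eta s = 0.
Proof.
move=> e0 se; have l0 : ln (s / eta) <= 0 by apply: ln_le0; rewrite ler_pdivrMr // mul1r.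
by rewrite /logcut /dlogcut /possq pos_le // expr0n mulr0 mul0r.
Qed.

Lemma logcut_gt eta s : 0 < eta -> eta < s ->
  let L := ln (s / eta) in logcut eta s = L ^+ 2 /\ dlogcut eta s = 2 * L / s.
Proof.
move=> e0 se; have l0 : 0 <= ln (s / eta) by apply: ln_ge0; rewrite ler_pdivlMr // mul1r ltW.
by rewrite /logcut /dlogcut /possq pos_ge.
Qed.

Lemma is_derive_logcut eta s : 0 < eta -> is_derive s 1 (logcut eta) (dlogcut eta s).
Proof.
move=> e0; have [s_small|s_large] := ltP s eta.
  have [_ ->] := logcut_le e0 (ltW s_small).
  have E : \forall u \near s, cst 0 u = logcut eta u.
    near=> u; have [//|-> //] := @logcut_le eta u e0 _.
    by apply: ltW; near: u; exact: lt_nbhsl.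
  by apply: near_eq_is_derive E _.
(* The endpoint s = eta belongs to this case: [possq] is differentiable at 0, so the chain rule
   covers it. *)
have s0 : 0 < s by apply: lt_le_trans s_large.
have se0 : 0 < s / eta by rewrite divr_gt0.
have D1 : is_derive s 1 (fun u : R => u / eta) eta^-1.
  have -> : (fun u : R => u / eta) = eta^-1 \*: (id : R -> R).
    by apply/funext => u; rewrite /= mulrC.
  by apply: is_derive_eq; rewrite /GRing.scale /= mulr1.
have D2 := @is_derive1_comp _ (@ln R) (fun u => u / eta) s _ _ (is_derive1_ln se0) D1.
have D3 := @is_derive1_comp _ possq _ s _ _ (is_derive_possq (ln (s / eta))) D2.
apply: is_derive_eq D3 _.
by rewrite /dlogcut /GRing.scale /=; field; rewrite (gt_eqF e0) (gt_eqF s0).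
Unshelve. all: by end_near. Qed.

Lemma dlogcut_continuous eta : 0 < eta -> continuous (dlogcut eta).
Proof.
move=> e0 s; have [s_small|s_large] := ltP s eta.
  have [_ E0] := logcut_le e0 (ltW s_small).
  rewrite /continuous_at E0; apply: (@cvg_trans _ ((fun=> 0 : R) @ nbhs s)); last by apply: cvg_cst.
  apply: near_eq_cvg; near=> u.
  have ue : u <= eta by apply: ltW; near: u; exact: lt_nbhsl.
  by rewrite (logcut_le e0 ue).2.
have s0 : 0 < s by apply: lt_le_trans s_large.
have se0 : 0 < s / eta by rewrite divr_gt0.
have c1 : {for s, continuous (fun u : R => u / eta)}.
  by apply: continuousM; [exact: cvg_id | exact: cst_continuous].
have c2 : {for s, continuous (fun u : R => ln (u / eta))}.
  by apply: (continuous_comp c1); exact: continuous_ln.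
have c3 : {for s, continuous (fun u : R => pos (ln (u / eta)))}.
  by apply: (continuous_comp c2); exact: pos_continuous.
apply: (@continuousM _ _ (fun u : R => 2 * pos (ln (u / eta))) (fun u => u^-1)).
  apply: (@continuousM _ _ (fun=> 2) (fun u : R => pos (ln (u / eta)))) => //.
  exact: cst_continuous.
by apply: (@continuousV _ _ id); [rewrite gt_eqF | exact: cvg_id].
Unshelve. all: by end_near. Qed.

Lemma Ck1_comp n (U : set 'rV[R]_n) (f : 'rV[R]_n -> R) (h dh : R -> R) :
  open U -> (forall s, is_derive s 1 h (dh s)) -> continuous dh ->
  Ck 1 U f -> Ck 1 U (h \o f) /\
  (forall i x, U x -> partial i (h \o f) x = dh (f x) * partial i f x).
Proof.
move=> oU Dh cdh [df pf].
have E i x : U x -> partial i (h \o f) x = dh (f x) * partial i f x.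
  move=> Ux; have [Dhx <-] := Dh (f x).
  by rewrite (partial_comp i (df x Ux) Dhx) derive1E.
split => //; split=> [x Ux|i].
  apply: differentiable_comp; first exact: df.
  by apply/derivable1_diffP; have [] := Dh (f x).
apply: (@Ck_ext _ _ U oU _ 0 (fun x => dh (f x) * partial i f x)).
  by move=> x Ux; rewrite E.
move=> x Ux; apply: (@continuousM _ _ (fun y => dh (f y)) (partial i f)).
  apply: (@continuous_comp _ _ _ f dh); last exact: cdh.
  exact/differentiable_continuous/df.
exact: (pf i).
Qed.

End Cutoff.

(** * The divergence argument *)

Lemma quadratic_beats_affine (R : realFieldType) (al be ga : R) : 0 < al -> 0 <= be ->
  exists2 t, 0 < t & be * (t + ga) < al * t ^+ 2.
Proof.
(* Then t >= 1 gives t + ga <= (1 + |ga|) t, and al * t exceeds be * (1 + |ga|). *)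
move=> al0 be0; pose t := be * (1 + `|ga|) / al + 1.
have g0 := normr_ge0 ga; have g1 := ler_norm ga.
have q0 : 0 <= be * (1 + `|ga|) / al by rewrite divr_ge0 ?mulr_ge0 ?(ltW al0) // addr_ge0.
have t1 : 1 <= t by rewrite /t; lra.
have t0 : 0 < t by lra.
exists t => //; apply: (@le_lt_trans _ _ (be * (1 + `|ga|) * t)).
  rewrite -mulrA ler_wpM2l // mulrDl mul1r lerD2l.
  by apply: le_trans g1 _; rewrite ler_peMr.
have at_ : al * t = be * (1 + `|ga|) + al by rewrite /t; field; rewrite (gt_eqF al0).
rewrite expr2 mulrA at_.
by rewrite ltr_pM2r // ltrDl.
Qed.

Section CoordinateCalculus.
Context {R : realType} {n : nat}.
Implicit Types (x a : 'rV[R]_n) (U : set 'rV[R]_n).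

Lemma partial_coord (i j : 'I_n) x : partial i (fun y : 'rV[R]_n => y 0 j) x = (i == j)%:R.
Proof.
have d : is_derive x (delta_mx 0 i) (fun y : 'rV[R]_n => y 0 j) ((i == j)%:R).
  have E : (fun h : R => h^-1 *: ((h *: delta_mx 0 i + x) 0 j - x 0 j)) =
      (fun h : R => h^-1 * (h * (i == j)%:R)).
    by apply/funext => h; rewrite !mxE eqxx /= addrK eq_sym.
  have C : (fun h : R => h^-1 * (h * (i == j)%:R)) @ 0^' --> ((i == j)%:R : R).
    apply: (@cvg_trans _ ((fun=> (i == j)%:R : R) @ 0^')); last by apply: cvg_cst.
    apply: near_eq_cvg; near=> h; rewrite mulKf //.
    by near: h; exact: nbhs_dnbhs_neq.
  split; first by rewrite /derivable /= E; apply/cvg_ex; exists ((i == j)%:R).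
  by rewrite /derive /= E; apply/cvg_lim.
by rewrite /partial; apply: derive_val.
Unshelve. all: by end_near. Qed.

Lemma Ck_coord k U (j : 'I_n) : open U -> Ck k U (fun y : 'rV[R]_n => y 0 j).
Proof.
move=> oU; case: k => [|k].
  by move=> x _; exact/differentiable_continuous/differentiable_coord.
split=> [x _|i]; first exact: differentiable_coord.
by apply: (Ck_ext oU _ (Ck_cst oU k ((i == j)%:R))) => x _; rewrite partial_coord.
Qed.

Lemma Ck_dist2 k U a : open U -> Ck k U (fun x => dot (x - a) (x - a)).
Proof.
move=> oU.
apply: (@Ck_ext _ _ U oU _ k (fun x => \sum_j (x 0 j - a 0 j) * (x 0 j - a 0 j))).
  by move=> x _; rewrite dotE; apply: eq_bigr => j _; rewrite !mxE.
apply: Ck_big_sum => // j; apply: CkM => //; apply: CkB => //; try exact: Ck_cst.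
  exact: Ck_coord.
exact: Ck_coord.
Qed.

Lemma partial_dist2 i x a :
  partial i (fun x => dot (x - a) (x - a)) x = 2 * (x 0 i - a 0 i).
Proof.
have -> : (fun x : 'rV[R]_n => dot (x - a) (x - a)) =
    (fun x => \sum_j (x 0 j - a 0 j) * (x 0 j - a 0 j)).
  by apply/funext => y; rewrite dotE; apply: eq_bigr => j _; rewrite !mxE.
have d j : differentiable (fun y : 'rV[R]_n => y 0 j - a 0 j) x.
  by apply: differentiableB; [exact: differentiable_coord|exact: differentiable_cst].
have p j : partial i (fun y : 'rV[R]_n => y 0 j - a 0 j) x = (i == j)%:R.
  rewrite partialB; [|exact: differentiable_coord|exact: differentiable_cst].
  by rewrite partial_coord partial_cst subr0.
rewrite partial_sum; last by move=> j; exact: differentiableM.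
rewrite (bigD1 i) //= big1; last first.
  by move=> j /negPf ji; rewrite partialM // p eq_sym ji mul0r mulr0 addr0.
by rewrite partialM // p eqxx /=; ring.
Qed.

End CoordinateCalculus.

(** * The test field and the lower bound for its divergence *)

Section Contradiction.
Context {R : realType} {n : nat}.
Variables (U : set 'rV[R]_n) (q a x1 : 'rV[R]_n) (l c C r2 tau : R).
Variables (S : 'rV[R]_n -> R) (T : 'I_n -> 'I_n -> 'rV[R]_n -> R).
Hypothesis oU : open U.
Hypothesis l0 : 0 < l.
Hypothesis boxU : box q l `<=` U.
Hypothesis c0 : 0 < c.
Hypothesis C0 : 0 < C.
Hypothesis r20 : 0 < r2.
Hypothesis tau0 : 0 < tau.
Hypothesis tau1 : tau <= 1.
Hypothesis tau_small : tau * (n%:R * C) <= c * r2.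
Hypothesis CS : Ck 1 U S.
Hypothesis CT : forall i j, Ck 1 U (T i j).
Hypothesis T_lower : forall x u, box q l x -> 0 < S x ->
  c * S x * dot u u <= \sum_j \sum_i u 0 j * T j i x * u 0 i.
Hypothesis T_upper : forall x i j, box q l x -> 0 < S x -> `|T j i x| <= C * S x.
Hypothesis T_div : forall x j, box q l x -> 0 < S x ->
  `|\sum_i partial i (T j i) x| <= C * S x.
Hypothesis S_upper : forall x, box q l x -> S x <= C.
Hypothesis dS_upper : forall i x, box q l x -> `|partial i S x| <= C.
Hypothesis a_close : forall x i, box q l x -> `|x 0 i - a 0 i| <= 1.
Hypothesis S_outside : forall x, box q l x -> 0 < S x -> r2 <= dot (x - a) (x - a).
Hypothesis ball_in : forall i x, box q l x -> `|q 0 i - x 0 i| = l ->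
  r2 + tau <= dot (x - a) (x - a).
Hypothesis x1_in : `|q - x1| < l.
Hypothesis x1_S : 0 < S x1.
Hypothesis x1_ball : dot (x1 - a) (x1 - a) < r2 + tau.

(* Positive on a ball slightly larger than the one where S is known to be <= 0. *)
Let f (x : 'rV[R]_n) := r2 + tau - dot (x - a) (x - a).
(** Half of T applied to the gradient of [f], so that differentiating the cutoff in [f] yields a
    value of the quadratic form T. *)
Let W (i : 'I_n) (x : 'rV[R]_n) := \sum_j (a 0 j - x 0 j) * T j i x.
Let V (eta : R) (i : 'I_n) (x : 'rV[R]_n) := logcut eta (S x) * possq (f x) * W i x.

Lemma Ck_f : Ck 1 U f.
Proof. exact: (CkB oU (Ck_cst oU 1 (r2 + tau)) (Ck_dist2 1 a oU)). Qed.

Lemma partial_f i x : U x -> partial i f x = - 2 * (x 0 i - a 0 i).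
Proof.
move=> Ux; rewrite partialB; [|exact: differentiable_cst|]; last first.
  by have [+ _] := @Ck_dist2 R n 1 U a oU; apply.
by rewrite partial_cst partial_dist2; ring.
Qed.

Lemma Ck_W i : Ck 1 U (W i).
Proof.
apply: (@Ck_big_sum _ _ _ oU 1 _ _ _ (fun j y => (a 0 j - y 0 j) * T j i y)) => j.
exact: (CkM oU (CkB oU (Ck_cst oU 1 (a 0 j)) (Ck_coord 1 j oU)) (CT j i)).
Qed.

Lemma partial_W i x : U x ->
  partial i (W i) x = - T i i x + \sum_j (a 0 j - x 0 j) * partial i (T j i) x.
Proof.
move=> Ux.
have dT j : differentiable (T j i) x by have [+ _] := CT j i; apply.
have d j : differentiable (fun y : 'rV[R]_n => a 0 j - y 0 j) x.
  by apply: differentiableB; [exact: differentiable_cst|exact: differentiable_coord].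
have p j : partial i (fun y : 'rV[R]_n => a 0 j - y 0 j) x = - (i == j)%:R.
  rewrite partialB; [|exact: differentiable_cst|exact: differentiable_coord].
  by rewrite partial_coord partial_cst sub0r.
rewrite /W partial_sum; last by move=> j; exact: differentiableM.
under eq_bigr => j _ do rewrite partialM // p.
rewrite big_split /=; congr (_ + _).
rewrite (bigD1 i) //= big1 ?addr0 ?eqxx ?mulN1r //.
by move=> j /negPf ji; rewrite eq_sym ji oppr0 mul0r.
Qed.

Section Eta.
Variable eta : R.
Hypothesis eta0 : 0 < eta.

Lemma Ck_cutoff : Ck 1 U (logcut eta \o S) /\
  (forall i x, U x -> partial i (logcut eta \o S) x = dlogcut eta (S x) * partial i S x).
Proof.
exact: (Ck1_comp oU (fun s => is_derive_logcut s eta0) (dlogcut_continuous eta0) CS).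
Qed.

Lemma Ck_possq_f : Ck 1 U (possq \o f) /\
  (forall i x, U x -> partial i (possq \o f) x = 2 * pos (f x) * partial i f x).
Proof.
have c2 : continuous (fun t : R => 2 * pos t).
  move=> s; apply: (@continuousM _ _ (fun=> 2) pos); first exact: cst_continuous.
  exact: pos_continuous.
exact: (Ck1_comp oU is_derive_possq c2 Ck_f).
Qed.

Lemma Ck_V i : Ck 1 U (V eta i).
Proof.
exact: (CkM oU (CkM oU Ck_cutoff.1 Ck_possq_f.1) (Ck_W i)).
Qed.

Lemma partial_V i x : U x -> partial i (V eta i) x =
  dlogcut eta (S x) * possq (f x) * (partial i S x * W i x)
  + logcut eta (S x) * (4 * pos (f x)) * ((a 0 i - x 0 i) * W i x)
  + logcut eta (S x) * possq (f x) * partial i (W i) x.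
Proof.
move=> Ux.
have [[d1 _] p1] := Ck_cutoff; have [[d2 _] p2] := Ck_possq_f.
have [d3 _] := Ck_W i.
have d12 : differentiable (fun y => (logcut eta \o S) y * (possq \o f) y) x.
  by apply: differentiableM; [exact: d1 | exact: d2].
rewrite [LHS](_ : _ = partial i
   (fun y => ((logcut eta \o S) y * (possq \o f) y) * W i y) x) //.
rewrite (partialM i d12 (d3 x Ux)) (partialM i (d1 x Ux) (d2 x Ux)).
rewrite p1 // p2 // partial_f //=; ring.
Qed.

Lemma divergence_V x : U x -> divergence (V eta) x =
  dlogcut eta (S x) * possq (f x) * \sum_i (partial i S x * W i x)
  + logcut eta (S x) * (4 * pos (f x)) *
      (\sum_j \sum_i (x - a) 0 j * T j i x * (x - a) 0 i)
  + logcut eta (S x) * possq (f x) *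
      (- (\sum_i T i i x) + \sum_j (a 0 j - x 0 j) * \sum_i partial i (T j i) x).
Proof.
move=> Ux; rewrite /divergence (eq_bigr _ (fun i _ => partial_V i Ux)).
rewrite big_split big_split /= -!mulr_sumr; congr (_ + _ * _ + _ * _).
  rewrite [RHS]exchange_big; apply: eq_bigr => i _ /=; rewrite /W mulr_sumr.
  by apply: eq_bigr => j _; rewrite !mxE; ring.
rewrite (eq_bigr _ (fun i _ => partial_W i Ux)) big_split /= sumrN; congr (_ + _).
by rewrite exchange_big; apply: eq_bigr => j _ /=; rewrite mulr_sumr.
Qed.

Let L (x : 'rV[R]_n) := ln (S x / eta).

Lemma divergence_zero x : box q l x -> S x <= eta \/ f x <= 0 ->
  divergence (V eta) x = 0.
Proof.
move=> bx H; rewrite divergence_V; last exact: boxU.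
case: H => [Sx|fx]; first by have [-> ->] := logcut_le eta0 Sx; rewrite !mul0r !addr0.
by rewrite /possq pos_le // expr0n !(mulr0, mul0r, addr0).
Qed.

Lemma divergence_lower x : box q l x -> eta < S x -> 0 < f x ->
  2 * L x ^+ 2 * f x * (c * r2 * S x) - 2 * (n%:R * C) ^+ 2 * L x
  <= divergence (V eta) x.
Proof.
move=> bx Sx fx; rewrite divergence_V; last exact: boxU.
have [-> ->] := logcut_gt eta0 Sx; rewrite -/(L x).
have: 0 < L x by apply: ln_gt0; rewrite ltr_pdivlMr // mul1r.
move: (L x) => Lx L0.
have S0 : 0 < S x by exact: lt_trans Sx.
rewrite /possq pos_ge ?(ltW fx) //.
(* Where S is positive, the distance to [a] is at least the square root of [r2]. *)
have ft : f x <= tau by have := S_outside bx S0; rewrite /f; lra.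
have n0 : 0 <= n%:R :> R by exact: ler0n.
have Y j : `|a 0 j - x 0 j| <= 1 by rewrite distrC a_close.
have Wb i : `|W i x| <= n%:R * (C * S x).
  apply: le_trans (ler_norm_sum _ _ _) _.
  apply: (@le_trans _ _ (\sum_(j < n) C * S x)).
    apply: ler_sum => j _; rewrite normrM -[leRHS]mul1r.
    by apply: ler_pM => //; exact: T_upper.
  by rewrite sumr_const card_ord -[leLHS]mulr_natl.
have B1 : `|\sum_i (partial i S x * W i x)| <= n%:R * (C * (n%:R * (C * S x))).
  apply: le_trans (ler_norm_sum _ _ _) _.
  apply: (@le_trans _ _ (\sum_(j < n) (C * (n%:R * (C * S x))))).
    by apply: ler_sum => j _; rewrite normrM; apply: ler_pM => //; exact: dS_upper.
  by rewrite sumr_const card_ord -[leLHS]mulr_natl.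
have B2 : c * S x * r2 <= \sum_j \sum_i (x - a) 0 j * T j i x * (x - a) 0 i.
  apply: le_trans (T_lower (x - a) bx S0); apply: ler_wpM2l; last exact: S_outside.
  by rewrite mulr_ge0 // ltW.
have B3 : `|\sum_i T i i x| <= n%:R * (C * S x).
  apply: le_trans (ler_norm_sum _ _ _) _.
  apply: (@le_trans _ _ (\sum_(j < n) C * S x)).
    by apply: ler_sum => j _; exact: T_upper.
  by rewrite sumr_const card_ord -[leLHS]mulr_natl.
have B4 : `|\sum_j (a 0 j - x 0 j) * \sum_i partial i (T j i) x| <= n%:R * (C * S x).
  apply: le_trans (ler_norm_sum _ _ _) _.
  apply: (@le_trans _ _ (\sum_(j < n) C * S x)).
    apply: ler_sum => j _; rewrite normrM -[leRHS]mul1r.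
    by apply: ler_pM => //; exact: T_div.
  by rewrite sumr_const card_ord -[leLHS]mulr_natl.
move: B1 B2 B3 B4.
set A1 := \sum_i (partial i S x * W i x).
set A2 := \sum_j \sum_i (x - a) 0 j * T j i x * (x - a) 0 i.
set A3 := \sum_i T i i x.
set A4 := \sum_j (a 0 j - x 0 j) * \sum_i partial i (T j i) x.
move: A1 A2 A3 A4 => A1 A2 A3 A4 B1 B2 B3 B4.
(* The cutoff error: the factor 1 / S from the logarithm cancels the factor S in the bound for W. *)
have H1 : - (2 * (n%:R * C) ^+ 2 * Lx) <= 2 * Lx / S x * f x ^+ 2 * A1.
  have f2 : f x ^+ 2 <= 1 by rewrite expr_le1 ?(ltW fx) // (le_trans ft).
  rewrite lerNl; apply: le_trans (ler_norm _) _; rewrite normrN normrM.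
  rewrite ger0_norm; last by rewrite mulr_ge0 ?divr_ge0 ?mulr_ge0 ?exprn_ge0 ?(ltW L0) ?(ltW S0) ?(ltW fx).
  apply: (@le_trans _ _ (2 * Lx / S x * 1 * (n%:R * (C * (n%:R * (C * S x)))))).
    apply: ler_pM => //.
      by rewrite mulr_ge0 ?divr_ge0 ?mulr_ge0 ?exprn_ge0 ?(ltW L0) ?(ltW S0) ?(ltW fx).
    by apply: ler_wpM2l f2; rewrite divr_ge0 ?mulr_ge0 ?(ltW L0) ?(ltW S0).
  by rewrite le_eqVlt; apply/orP; left; apply/eqP; field; rewrite (gt_eqF S0).
(* The gain, with coefficient 4; the next step spends half of it. *)
have H2 : 4 * Lx ^+ 2 * f x * (c * r2 * S x) <= Lx ^+ 2 * (4 * f x) * A2.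
  have -> : 4 * Lx ^+ 2 * f x * (c * r2 * S x) = Lx ^+ 2 * (4 * f x) * (c * S x * r2) by ring.
  by apply: ler_wpM2l B2; rewrite !mulr_ge0 ?exprn_ge0 ?(ltW L0) ?(ltW fx).
(* One factor of f^2 is at most [tau], which [tau_small] makes small against the gain. *)
have H3 : - (2 * Lx ^+ 2 * f x * (c * r2 * S x)) <= Lx ^+ 2 * f x ^+ 2 * (- A3 + A4).
  have h : - (2 * (n%:R * (C * S x))) <= - A3 + A4.
    by move: B3 B4; rewrite !ler_norml => /andP[? ?] /andP[? ?]; lra.
  apply: (@le_trans _ _ (Lx ^+ 2 * f x ^+ 2 * - (2 * (n%:R * (C * S x))))); last first.
    by apply: ler_wpM2l h; rewrite mulr_ge0 ?exprn_ge0 ?(ltW L0) ?(ltW fx).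
  rewrite mulrN lerN2.
  have -> : Lx ^+ 2 * f x ^+ 2 * (2 * (n%:R * (C * S x))) =
    2 * Lx ^+ 2 * f x * S x * (f x * (n%:R * C)) by ring.
  have -> : 2 * Lx ^+ 2 * f x * (c * r2 * S x) = 2 * Lx ^+ 2 * f x * S x * (c * r2) by ring.
  apply: ler_wpM2l; first by rewrite !mulr_ge0 ?exprn_ge0 ?(ltW L0) ?(ltW fx) ?(ltW S0).
  by apply: le_trans tau_small; apply: ler_wpM2r ft; rewrite mulr_ge0 // ltW.
lra.
Qed.

End Eta.

Lemma divergence_contradiction : False.
Proof.
have Ux1 : U x1 by apply: boxU; exact: ltW.
have f1 : 0 < f x1 by rewrite /f subr_gt0.
have cS : {for x1, continuous S} by have [d _] := CS; exact/differentiable_continuous/d.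
have cf : {for x1, continuous f} by have [d _] := Ck_f; exact/differentiable_continuous/d.
have [d1 d10 Hd1] := continuous_normP cS (divr_gt0 x1_S (ltr0n _ 2)).
have [d2 d20 Hd2] := continuous_normP cf (divr_gt0 f1 (ltr0n _ 2)).
pose rho := Num.min d1 d2 / 2.
have m0 : 0 < Num.min d1 d2 by rewrite lt_min d10 d20.
have rho0 : 0 < rho by rewrite divr_gt0.
pose s0 := S x1 / 2; pose f0 := f x1 / 2.
have s00 : 0 < s0 by rewrite divr_gt0.
have f00 : 0 < f0 by rewrite divr_gt0.
have nearx1 x : `|x1 - x| <= rho -> s0 < S x /\ f0 < f x.
  move=> xr; have xm : `|x1 - x| < Num.min d1 d2.
    by apply: le_lt_trans xr _; rewrite /rho; lra.
  move: xm; rewrite lt_min => /andP[/Hd1 + /Hd2]; rewrite !ltr_norml.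
  by rewrite /s0 /f0 => /andP[? ?] /andP[? ?]; lra.
pose Kn : R := (Num.bound (2 * l / rho)).+1%:R ^+ n.
have Kn0 : 0 < Kn by rewrite exprn_gt0.
pose be := 2 * (n%:R * C) ^+ 2.
have be0 : 0 <= be by rewrite mulr_ge0 ?exprn_ge0 ?mulr_ge0 ?ler0n ?(ltW C0).
pose al := 2 * f0 * (c * r2 * s0) / Kn.
have al0 : 0 < al by rewrite divr_gt0 ?mulr_gt0.
have [t t0 Ht] := quadratic_beats_affine (ln (C / s0)) al0 be0.
(* With this choice L >= t near [x1], where S > s0, and L <= t + ln (C / s0) wherever S > eta, since
   S <= C. *)
pose eta := s0 * expR (- t).
have e0 : 0 < eta by rewrite mulr_gt0 ?expR_gt0.
have es0 : eta < s0 by rewrite /eta gtr_pMr // -expR0 ltr_expR oppr_lt0.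
have lns0 : ln (s0 / eta) = t.
  rewrite /eta invfM mulrA divff ?gt_eqF // mul1r -expRN opprK expRK //.
have Cs0 : s0 <= C.
  have h : S x1 <= C by apply: S_upper; exact: ltW.
  by move: h x1_S; rewrite /s0; lra.
have lnC : ln (C / eta) = t + ln (C / s0).
  rewrite -lns0 -lnM ?posrE ?divr_gt0 //; congr ln.
  by field; rewrite (gt_eqF s00) (gt_eqF e0).
have Lmax x : box q l x -> eta < S x -> ln (S x / eta) <= t + ln (C / s0).
  move=> bx Sx; have Sx0 := lt_trans e0 Sx.
  by rewrite -lnC ler_ln ?posrE ?divr_gt0 // ler_pM2r ?invr_gt0 // S_upper.
have tC : 0 <= t + ln (C / s0).
  by rewrite -lnC ln_ge0 // ler_pdivlMr // mul1r (le_trans (ltW es0)).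
pose m := be * (t + ln (C / s0)).
have m00 : 0 <= m by rewrite mulr_ge0.
pose M := 2 * t ^+ 2 * f0 * (c * r2 * s0).
have M0 : 0 <= M by apply: ltW; rewrite /M !mulr_gt0 ?exprn_gt0.
have lower x : box q l x -> - m <= divergence (V eta) x.
  move=> bx; have [Sx|Sx] := leP (S x) eta.
    by rewrite divergence_zero ?oppr_le0 //; left.
  have [fx|fx] := leP (f x) 0; first by rewrite divergence_zero ?oppr_le0 //; right.
  apply: le_trans (divergence_lower e0 bx Sx fx).
  have h1 := ler_wpM2l be0 (Lmax x bx Sx).
  have h2 : 0 <= 2 * ln (S x / eta) ^+ 2 * f x * (c * r2 * S x).
    apply: mulr_ge0; last by apply: ltW; rewrite !mulr_gt0 ?(lt_trans e0 Sx).
    by apply: mulr_ge0; [apply: mulr_ge0 => //; exact: sqr_ge0 | exact: ltW].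
  by rewrite -/be /m; lra.
have good x : box q l x -> `|x1 - x| <= rho -> M - m <= divergence (V eta) x.
  move=> bx /nearx1[Sx fx]; have Sx' := lt_trans es0 Sx.
  apply: le_trans (divergence_lower e0 bx Sx' (lt_trans f00 fx)).
  have h1 := ler_wpM2l be0 (Lmax x bx Sx').
  have lt : t <= ln (S x / eta).
    rewrite -lns0 ler_ln ?posrE ?divr_gt0 ?(lt_trans e0 Sx') //.
    by rewrite ler_pM2r ?invr_gt0 // ltW.
  have h2 : M <= 2 * ln (S x / eta) ^+ 2 * f x * (c * r2 * S x).
    rewrite /M; apply: ler_pM.
    - by apply: ltW; rewrite !mulr_gt0 ?exprn_gt0.
    - by apply: ltW; rewrite !mulr_gt0.
    - apply: ler_pM; [|exact: ltW| |exact: ltW].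
        by apply: ltW; rewrite mulr_gt0 ?exprn_gt0.
      apply: ler_wpM2l => //; rewrite lerXn2r // nnegrE ?(ltW t0) //.
      exact: le_trans (ltW t0) lt.
    - by apply: ler_wpM2l; [apply: ltW; rewrite mulr_gt0 | exact: ltW].
  by rewrite -/be /m; lra.
have key := @divergence_average R n q l l0 (V eta) _ _ _ x1 rho m M x1_in rho0 M0 lower good.
have : M / Kn <= m.
  apply: key.
  - by move=> i x bx; apply: diff_derivable; have [+ _] := Ck_V e0 i; apply; exact: boxU.
  - by move=> i x bx; have [_ /(_ i)] := Ck_V e0 i; apply; exact: boxU.
  (* On the faces [ball_in] gives f <= 0, so the field vanishes there. *)
  - move=> i x bx qx; rewrite /V /possq pos_le ?expr0n ?mulr0 ?mul0r //.
    by rewrite subr_le0 (ball_in bx qx).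
have -> : M / Kn = al * t ^+ 2 by rewrite /M /al; field; rewrite (gt_eqF Kn0).
by rewrite leNgt Ht.
Qed.

End Contradiction.

(** * Local estimates *)

Lemma common_radius (R : realType) (V : normedModType R) (q : V) (I : finType)
    (P : I -> V -> Prop) :
  (forall i, exists2 d : R, 0 < d & forall y, `|q - y| < d -> P i y) ->
  exists2 d : R, 0 < d & forall i y, `|q - y| < d -> P i y.
Proof.
move=> H.
have /choice[d dP] i : exists d : R, 0 < d /\ forall y, `|q - y| < d -> P i y.
  by have [d d0 dP] := H i; exists d.
exists (\big[Num.min/1]_i d i).
  by apply/bigmin_gtP; split => // i _; have [] := dP i.
move=> i y qy; have [_] := dP i; apply.
by apply: lt_le_trans qy _; exact: bigmin_le_cond.
Qed.

Lemma locally_bounded (R : realType) (V : normedModType R) (q : V) (I : finType)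
    (F : I -> V -> R) : (forall i, {for q, continuous (F i)}) ->
  exists2 d : R, 0 < d & exists2 B : R, 0 < B &
    forall i y, `|q - y| < d -> `|F i y| <= B.
Proof.
move=> cF; pose B := 1 + \sum_i `|F i q|.
have s0 : 0 <= \sum_i `|F i q| by exact: sumr_ge0.
have B0 : 0 < B by rewrite /B; lra.
have [i|d d0 dP] := @common_radius R V q I (fun i y => `|F i y| <= B).
  have [d d0 dP] := continuous_normP (cF i) (@ltr01 R).
  exists d => // y /dP qy; rewrite /B.
  have h1 : `|F i q| <= \sum_i `|F i q|.
    by rewrite (bigD1 i) //= lerDl sumr_ge0.
  have h2 := ler_distD (F i q) (F i y) 0; rewrite !subr0 distrC in h2.
  lra.
by exists d => //; exists B.
Qed.

(** * Lower bounds for positive definite forms *)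

Section PositiveDefinite.
Context {R : realType} {n : nat}.

Lemma bil_continuous (A : 'M[R]_n) (v : 'rV[R]_n) :
  {for v, continuous (fun v => bil A v v)}.
Proof.
have C : Ck 0 [set: 'rV[R]_n] (fun v => \sum_i \sum_j v 0 i * A i j * v 0 j).
  apply: (Ck_big_sum openT) => i; apply: (Ck_big_sum openT) => j.
  have c k := @Ck_coord R n 0 _ k openT.
  exact: (CkM openT (CkM openT (c i) (Ck_cst openT 0 (A i j))) (c j)).
have E : (fun v : 'rV[R]_n => bil A v v) = (fun v => \sum_i \sum_j v 0 i * A i j * v 0 j).
  by apply/funext => w; rewrite bilE.
by rewrite E; exact: C.
Qed.

Lemma coord_sq_le (v : 'rV[R]_n) i : v 0 i ^+ 2 <= dot v v.
Proof.
rewrite dotE (bigD1 i) //= -expr2 lerDl sumr_ge0 // => j _.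
by rewrite -expr2 sqr_ge0.
Qed.

(** The constant is the minimum of the form on the compact Euclidean unit sphere, nonempty as n > 0;
    homogeneity does the rest. *)
Lemma posdef_lower (A : 'M[R]_n) : (0 < n)%N ->
  (forall v, v != 0 -> 0 < bil A v v) ->
  exists2 lam : R, 0 < lam & forall v, lam * dot v v <= bil A v v.
Proof.
move=> n0 pA; pose Sph := (fun v : 'rV[R]_n => bil 1%:M v v) @^-1` [set 1].
have cSph : closed Sph.
  apply: preimage_closed; last exact: closed_eq.
  by move=> v _; apply: bil_continuous.
have bSph : bounded_set Sph.
  exists 1; split; first exact: num_real.
  move=> M M1 v /= v1; apply: le_trans (ltW M1).
  apply/(rV_norm_leP _ ler01) => i; rewrite -(@expr_le1 _ 2) //.
  by rewrite (real_normK (num_real _)); apply: le_trans (coord_sq_le v i) _; rewrite /dot v1.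
have Sph0 : Sph !=set0.
  exists (delta_mx 0 (Ordinal n0)).
  by rewrite /Sph /= bil_delta mxE eqxx.
have cb : {within Sph, continuous (fun v : 'rV[R]_n => bil A v v)}.
  by apply: continuous_in_subspaceT => v _; apply: bil_continuous.
have [w wS wmin] := EVT_min_rV Sph0 (bounded_closed_compact bSph cSph) cb.
have w1 : dot w w = 1 by move: wS; rewrite inE.
have w0 : w != 0.
  by apply: contra_eq_neq w1 => ->; rewrite /dot bil0l eq_sym oner_eq0.
exists (bil A w w); first exact: pA.
move=> v; have [->|v0] := eqVneq v 0; first by rewrite /dot !bil0l mulr0.
have d0 := dot_gt0 v0; pose s := Num.sqrt (dot v v).
have s0 : 0 < s by rewrite sqrtr_gt0.
have s2 : s * s = dot v v by rewrite -expr2 sqr_sqrtr // ltW.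
have vS : s^-1 *: v \in Sph.
  by rewrite inE /Sph /= bilZl bilZr -/(dot v v) -s2; field; rewrite gt_eqF.
have := wmin _ vS; rewrite bilZl bilZr => h.
have -> : bil A v v = s^-1 * (s^-1 * bil A v v) * dot v v.
  by rewrite -s2; field; rewrite gt_eqF.
by rewrite ler_pM2r.
Qed.

(** From |v_i v_j| <= (v_i^2 + v_j^2) / 2, summed over all i and j. *)
Lemma bil_perturb (A B : 'M[R]_n) e v :
  (forall i j, `|A i j - B i j| <= e) ->
  bil A v v - e * n%:R * dot v v <= bil B v v.
Proof.
move=> AB; rewrite lerBlDl -lerBlDr !bilE.
apply: (@le_trans _ _ (\sum_i \sum_j e / 2 * (v 0 i * v 0 i + v 0 j * v 0 j))).
  rewrite -sumrB; apply: ler_sum => i _; rewrite -sumrB; apply: ler_sum => j _.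
  have -> : v 0 i * A i j * v 0 j - v 0 i * B i j * v 0 j = (v 0 i * v 0 j) * (A i j - B i j).
    by ring.
  apply: le_trans (ler_norm _) _; rewrite normrM.
  have e0 : 0 <= e by apply: le_trans (AB i j).
  apply: (@le_trans _ _ (`|v 0 i * v 0 j| * e)); first by apply: ler_wpM2l.
  have : `|v 0 i * v 0 j| <= (v 0 i * v 0 i + v 0 j * v 0 j) / 2.
    by have := sqr_ge0 (v 0 i + v 0 j); have := sqr_ge0 (v 0 i - v 0 j);
      rewrite !expr2 ler_norml => h1 h2; apply/andP; split; lra.
  by move=> h; have := ler_wpM2r e0 h; lra.
under eq_bigr => i _ do rewrite -mulr_sumr big_split /= -dotE sumr_const card_ord.
rewrite -mulr_sumr big_split /= sumr_const card_ord sumrMnl -dotE.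
by rewrite -[dot v v *+ n]mulr_natl le_eqVlt; apply/orP; left; apply/eqP; field.
Qed.

End PositiveDefinite.

(** * Curvature estimates and the absence of a boundary inside one chart *)

Section Local.
Context {R : realType} {n : nat} {U : set 'rV[R]_n} {G : 'rV[R]_n -> 'M[R]_n}.
Hypothesis n3 : (3 <= n)%N.
Hypothesis oU : open U.
Hypothesis G_smooth : smooth_on U G.
Hypothesis G_sym : forall x, U x -> (G x)^T = G x.
Hypothesis G_pos : forall x v, U x -> v != 0 -> 0 < inner G x v v.
(* The sign: 1 when positive curvature is studied, -1 for negative curvature. *)
Variable sg : R.
Implicit Types (x : 'rV[R]_n) (i j k l : 'I_n).

Definition rc x i j k l : R := sg * curv_low G i j x k l.

Lemma Rm_form4 x u v w z :
  Rm G x u v w z = form4 (fun i j k l => curv_low G i j x k l) u v w z.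
Proof.
have row m : curvature G x u v w 0 m = \sum_(p : 'I_n * 'I_n * 'I_n)
    u 0 p.1.1 * v 0 p.1.2 * w 0 p.2 * curv G p.1.1 p.1.2 x p.2 m.
  rewrite mxE !pair_bigA; apply: eq_bigr => -[[i j] k] _ /=.
  by rewrite -(curvE (G := G)).
rewrite /Rm /inner mxE /form4.
pose F (p : 'I_n * 'I_n * 'I_n) (l : 'I_n) := u 0 p.1.1 * v 0 p.1.2 * w 0 p.2 * z 0 l *
  curv_low G p.1.1 p.1.2 x p.2 l.
rewrite -(pair_bigA _ F) /= exchange_big /=; apply: eq_bigr => l _.
rewrite [X in _ * X]mxE mxME mulr_suml.
transitivity (\sum_m \sum_(p : 'I_n * 'I_n * 'I_n) u 0 p.1.1 * v 0 p.1.2 * w 0 p.2 *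
    curv G p.1.1 p.1.2 x p.2 m * G x m l * z 0 l).
  by apply: eq_bigr => m _; rewrite -!mulr_suml; congr (_ * _ * _); exact: row.
rewrite exchange_big /=; apply: eq_bigr => p _.
rewrite /F curv_low.unlock mxME mulr_sumr; apply: eq_bigr => m _; ring.
Qed.

Lemma quad_rc x u v : quad (rc x) u v = sg * Rm G x u v v u.
Proof.
by rewrite Rm_form4 /quad /form4 mulr_sumr; apply: eq_bigr => p _; rewrite /rc; ring.
Qed.

Lemma rc12 x i j k l : rc x i j k l = - rc x j i k l.
Proof. by rewrite /rc (curv_low_anti12 i j) mxNE mulrN. Qed.

Lemma curv_low34 x i j k l : U x -> curv_low G i j x k l = - curv_low G i j x l k.
Proof.
move=> Ux; have /matrixP/(_ l k) := curv_low_anti34 oU G_smooth G_sym G_pos i j Ux.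
by rewrite mxE mxNE.
Qed.

Lemma rc34 x i j k l : U x -> rc x i j k l = - rc x i j l k.
Proof. by move=> Ux; rewrite /rc curv_low34 // mulrN. Qed.

Lemma rcB x i j k l : U x -> rc x i j k l + rc x j k i l + rc x k i j l = 0.
Proof.
move=> Ux; rewrite /rc -!mulrDr.
by rewrite (curv_low_bianchi1 oU G_sym) ?mulr0.
Qed.

Lemma Ck_rc (m : nat) i j k l : Ck m U (fun x => rc x i j k l).
Proof.
exact: (CkZ oU sg (Ckmx_curv_low oU G_smooth G_pos m i j k l)).
Qed.

Lemma Ck_scal (m : nat) : Ck m U (fun x => scal (rc x)).
Proof.
by apply: (Ck_big_sum oU) => i; apply: (Ck_big_sum oU) => j; exact: Ck_rc.
Qed.

Lemma Ck_ric (m : nat) j k : Ck m U (fun x => ric (rc x) j k).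
Proof. by apply: (Ck_big_sum oU) => i; exact: Ck_rc. Qed.

Lemma Ck_einst (m : nat) j k : Ck m U (fun x => einst (rc x) j k).
Proof.
exact: (CkB oU (CkM oU (Ck_scal m) (Ck_cst oU m _)) (CkZ oU 2 (Ck_ric m j k))).
Qed.

Lemma partial_rc p i j k l x : U x ->
  partial p (fun y => rc y i j k l) x = sg * dmx p (curv_low G i j) x k l.
Proof.
move=> Ux; have [d _] := Ckmx_curv_low oU G_smooth G_pos 1 i j k l.
by rewrite /rc (partialZ p _ (d x Ux)) dmxE.
Qed.

Lemma differentiable_rc i j k l x : U x -> differentiable (fun y => rc y i j k l) x.
Proof. by move=> Ux; have [d _] := Ck_rc 1 i j k l; exact: d. Qed.

Lemma partial_scal p x : U x -> partial p (fun y => scal (rc y)) x =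
  \sum_i \sum_j sg * dmx p (curv_low G i j) x j i.
Proof.
move=> Ux; rewrite /scal partial_sum; last first.
  by move=> i; apply: differentiable_sumf => j; exact: differentiable_rc.
apply: eq_bigr => i _; rewrite partial_sum; last by move=> j; exact: differentiable_rc.
by apply: eq_bigr => j _; rewrite partial_rc.
Qed.

Lemma partial_ric p j k x : U x -> partial p (fun y => ric (rc y) j k) x =
  \sum_i sg * dmx p (curv_low G i j) x k i.
Proof.
move=> Ux; rewrite /ric partial_sum; last by move=> i; exact: differentiable_rc.
by apply: eq_bigr => i _; rewrite partial_rc.
Qed.

Lemma partial_einst p j k x : U x -> partial p (fun y => einst (rc y) j k) x =
  partial p (fun y => scal (rc y)) x * (j == k)%:R - 2 * partial p (fun y => ric (rc y) j k) x.
Proof.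
move=> Ux; have [ds _] := Ck_scal 1; have [dr _] := Ck_ric 1 j k.
have dz (a : R) (f : 'rV[R]_n -> R) : differentiable f x -> differentiable (fun y => a * f y) x.
  by move=> df; apply: differentiableM => //; exact: differentiable_cst.
have -> : (fun y => einst (rc y) j k) =
    (fun y => (j == k)%:R * scal (rc y) - 2 * ric (rc y) j k).
  by apply/funext => y; rewrite /einst mulrC.
rewrite (partialB p (dz _ _ (ds x Ux)) (dz _ _ (dr x Ux))).
by rewrite (partialZ p _ (ds x Ux)) (partialZ p _ (dr x Ux)) [X in X - _]mulrC.
Qed.

Definition bianchi_rhs i j k x :=
  conn G i x *m curv_low G j k x + curv_low G j k x *m (conn G i x)^T
  + (conn G j x *m curv_low G k i x + curv_low G k i x *m (conn G j x)^T)
  + (conn G k x *m curv_low G i j x + curv_low G i j x *m (conn G k x)^T).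

(* The twice contracted second Bianchi identity, with the Euclidean metric of
   the chart doing the contraction. *)
Lemma div_einst j x : U x ->
  \sum_i partial i (fun y => einst (rc y) j i) x =
  sg * \sum_b \sum_c bianchi_rhs j b c x c b.
Proof.
move=> Ux.
have d12 p a b k l : dmx p (curv_low G a b) x k l = - dmx p (curv_low G b a) x k l.
  rewrite !dmxE -partialN; last first.
    by have [d _] := Ckmx_curv_low oU G_smooth G_pos 1 b a k l; exact: d.
  congr (partial _ _ _); apply/funext => y; by rewrite (curv_low_anti12 a b) mxNE.
have d34 p a b k l : dmx p (curv_low G a b) x k l = - dmx p (curv_low G a b) x l k.
  rewrite !dmxE -partialN; last first.
    by have [d _] := Ckmx_curv_low oU G_smooth G_pos 1 a b l k; exact: d.
  apply: near_eq_partial.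
  by apply: filterS (open_nbhs_nbhs (conj oU Ux)) => y Uy; exact: curv_low34.
(* Up to the sign [sg], [X] is the j-th derivative of the scalar contraction and [Y] the j-th
   component of the divergence of the Ricci contraction. *)
pose X := \sum_b \sum_c dmx j (curv_low G b c) x c b.
pose Y := \sum_b \sum_c dmx b (curv_low G c j) x b c.
have -> : \sum_i partial i (fun y => einst (rc y) j i) x = sg * (X - 2 * Y).
  rewrite (eq_bigr _ (fun i _ => partial_einst i j i Ux)) sumrB -mulr_sumr.
  have -> : \sum_i partial i (fun y => scal (rc y)) x * (j == i)%:R = sg * X.
    rewrite (bigD1 j) //= eqxx mulr1 big1 ?addr0; last first.
      by move=> i /negPf ij; rewrite eq_sym ij mulr0.
    rewrite partial_scal // /X mulr_sumr; apply: eq_bigr => b _.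
    by rewrite mulr_sumr.
  have -> : \sum_i partial i (fun y => ric (rc y) j i) x = sg * Y.
    rewrite /Y mulr_sumr; apply: eq_bigr => b _.
    by rewrite partial_ric // mulr_sumr.
  by ring.
congr (_ * _).
have E b c : bianchi_rhs j b c x c b = dmx j (curv_low G b c) x c b
    - dmx b (curv_low G c j) x b c - dmx c (curv_low G b j) x c b.
  rewrite /bianchi_rhs -(curv_low_bianchi2 oU G_smooth G_sym G_pos j b c Ux).
  by rewrite !mxDE (d34 b c j c b) (d12 c j b c b).
under [RHS]eq_bigr do under eq_bigr do rewrite E.
under [RHS]eq_bigr do rewrite !sumrB.
rewrite !sumrB -/X -/Y.
have -> : \sum_b \sum_c dmx c (curv_low G b j) x c b = Y by rewrite exchange_big.
by ring.
Qed.

(** The factor 6 n^3: [bianchi_rhs] has six matrix products, each entry is a sum of n terms, and the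
    contraction runs over n^2 pairs. *)
Lemma div_einst_bound j x (Gm B : R) : U x -> `|sg| <= 1 ->
  (forall i a b, `|conn G i x a b| <= Gm) ->
  (forall i j a b, `|curv_low G i j x a b| <= B) ->
  `|\sum_i partial i (fun y => einst (rc y) j i) x| <= 6 * n%:R ^+ 3 * Gm * B.
Proof.
move=> Ux sg1 HG HB; rewrite div_einst // normrM.
have m1 i a b c d : `|(conn G i x *m curv_low G a b x) c d| <= n%:R * (Gm * B).
  rewrite mxME; apply: le_trans (ler_norm_sum _ _ _) _.
  apply: (@le_trans _ _ (\sum_(m < n) Gm * B)).
    by apply: ler_sum => m _; rewrite normrM ler_pM.
  by rewrite sumr_const card_ord -[leLHS]mulr_natl.
have m2 i a b c d : `|(curv_low G a b x *m (conn G i x)^T) c d| <= n%:R * (Gm * B).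
  rewrite mxME; apply: le_trans (ler_norm_sum _ _ _) _.
  apply: (@le_trans _ _ (\sum_(m < n) Gm * B)).
    by apply: ler_sum => m _; rewrite normrM mulrC ler_pM // mxE.
  by rewrite sumr_const card_ord -[leLHS]mulr_natl.
have E b c : `|bianchi_rhs j b c x c b| <= 6 * (n%:R * (Gm * B)).
  rewrite /bianchi_rhs !mxDE.
  have h1 := m1 j b c c b; have h2 := m2 j b c c b; have h3 := m1 b c j c b.
  have h4 := m2 b c j c b; have h5 := m1 c j b c b; have h6 := m2 c j b c b.
  apply: le_trans (ler_normD _ _) _; apply: (@le_trans _ _ (4 * (n%:R * (Gm * B)) + 2 * (n%:R * (Gm * B)))); last by lra.
  apply: lerD; last by apply: le_trans (ler_normD _ _) _; lra.
  apply: le_trans (ler_normD _ _) _.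
  apply: (@le_trans _ _ (2 * (n%:R * (Gm * B)) + 2 * (n%:R * (Gm * B)))); last by lra.
  by apply: lerD; apply: le_trans (ler_normD _ _) _; lra.
apply: (@le_trans _ _ (\sum_(b < n) \sum_(c < n) 6 * (n%:R * (Gm * B)))).
  apply: (@le_trans _ _ (1 * `|\sum_b \sum_c bianchi_rhs j b c x c b|)).
    by apply: ler_wpM2r.
  rewrite mul1r; apply: le_trans (ler_norm_sum _ _ _) _; apply: ler_sum => b _.
  by apply: le_trans (ler_norm_sum _ _ _) _; apply: ler_sum => c _.
rewrite !sumr_const !card_ord -mulrnA -[leLHS]mulr_natl natrM.
by rewrite le_eqVlt; apply/orP; left; apply/eqP; ring.
Qed.

Hypothesis sg1 : `|sg| = 1.

(** [kap] plays the part of the largest curvature at x. It depends on x and is not bounded below,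
    whereas [del] will be uniform. *)
Definition pinched_at (del : R) x := exists2 kap : R, 0 < kap &
  forall u v, row_free (col_mx u v) ->
    del * kap <= quad (rc x) u v / area (G x) u v <= kap.

(** Ellipticity uniform near [q]: moving the entries by less than lam / (2n) costs at most half of
    the constant at [q]. *)
Lemma G_lower q : U q -> exists2 d : R, 0 < d & exists2 lam : R, 0 < lam &
  forall x v, `|q - x| < d -> lam * dot v v <= bil (G x) v v.
Proof.
move=> Uq; have n0 : (0 < n)%N by apply: leq_trans n3.
have nR : 0 < n%:R :> R by rewrite ltr0n.
have [lam lam0 Hlam] := posdef_lower n0 (fun v => @G_pos q v Uq).
have e0 : 0 < lam / (2 * n%:R) by rewrite divr_gt0 ?mulr_gt0.
have [|d d0 Hd] := @common_radius R _ q ('I_n * 'I_n)%type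
    (fun p y => `|G q p.1 p.2 - G y p.1 p.2| < lam / (2 * n%:R)).
  move=> p; have cG : {for q, continuous (fun y => G y p.1 p.2)}.
    by have := Ckmx_G oU G_smooth 0 p.1 p.2; apply.
  exact: continuous_normP cG e0.
exists d => //; exists (lam / 2); first by rewrite divr_gt0.
move=> x v qx; have H i j := ltW (Hd (i, j) x qx).
apply: le_trans (bil_perturb v H); have := Hlam v.
have -> : lam / (2 * n%:R) * n%:R = lam / 2 by field; rewrite gt_eqF.
lra.
Qed.

Lemma local_constants q (del : R) : U q -> 0 < del ->
  exists2 d : R, 0 < d & exists c C : R, [/\ 0 < c, 0 < C &
  forall x, `|q - x| < d -> U x ->
    [/\ scal (rc x) <= C,
        forall i, `|partial i (fun y => scal (rc y)) x| <= C &
        pinched_at del x ->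
    [/\ 0 < scal (rc x),
        forall u, c * scal (rc x) * dot u u <=
          \sum_j \sum_i u 0 j * einst (rc x) j i * u 0 i,
        forall i j, `|einst (rc x) j i| <= C * scal (rc x) &
        forall j, `|\sum_i partial i (fun y => einst (rc y) j i) x| <= C * scal (rc x)]]].
Proof.
move=> Uq del0; have nR : 0 < n%:R :> R by rewrite ltr0n (leq_trans _ n3).
have [d1 d10 [lam lam0 Hlam]] := G_lower Uq.
have [d2 d20 [Lam Lam0 HLam]] := locally_bounded (q := q)
  (F := fun (p : 'I_n * 'I_n) y => G y p.1 p.2)
  (fun p => Ckmx_G oU G_smooth 0 p.1 p.2 q Uq).
have [d3 d30 [Gm Gm0 HGm]] := locally_bounded (q := q)
  (F := fun (p : 'I_n * 'I_n * 'I_n) y => conn G p.1.1 y p.1.2 p.2)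
  (fun p => Ckmx_conn oU G_smooth G_pos 0 p.1.1 p.1.2 p.2 q Uq).
have [d4 d40 [Sm Sm0 HSm]] := locally_bounded (q := q)
  (F := fun (p : unit) y => scal (rc y)) (fun p => Ck_scal 0 q Uq).
have [d5 d50 [Dm Dm0 HDm]] := locally_bounded (q := q)
  (F := fun (p : 'I_n) => partial p (fun y => scal (rc y)))
  (fun p => (Ck_scal 1).2 p q Uq).
pose C1 := 48 * Lam ^+ 2 / (del * lam ^+ 2).
have C10 : 0 < C1 by rewrite divr_gt0 ?mulr_gt0 ?exprn_gt0.
(* [C1] is the constant of [r_bound]; [C2] bounds the entries of S I - 2 Ric and [C3] its
   divergence, both relative to S. The sum chosen for [C] below serves all bounds at once. *)
pose C2 := 1 + 2 * n%:R * C1; pose C3 := 6 * n%:R ^+ 3 * Gm * C1.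
have C20 : 0 < C2 by have := mulr_gt0 nR C10; rewrite /C2; lra.
have C30 : 0 < C3 by apply: mulr_gt0 C10; rewrite !mulr_gt0 ?exprn_gt0.
exists (Num.min (Num.min d1 d2) (Num.min d3 (Num.min d4 d5))).
  by rewrite !lt_min d10 d20 d30 d40 d50.
exists (del * lam ^+ 2 / (n%:R ^+ 2 * Lam ^+ 2)), (Sm + Dm + C2 + C3); split.
- by rewrite divr_gt0 ?mulr_gt0 ?exprn_gt0.
- lra.
move=> x; rewrite !lt_min => /andP[/andP[x1 x2] /and3P[x3 x4 x5]] Ux.
split.
- by have := HSm tt x x4; rewrite ler_norml => /andP[_]; lra.
- by move=> i; have := HDm i x x5; lra.
move=> [kap kap0 Hk].
have r12 := rc12 x.
have r34 i j k l : rc x i j k l = - rc x i j l k by exact: rc34.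
have rB i j k l : rc x i j k l + rc x j k i l + rc x k i j l = 0 by exact: rcB.
have sA := G_sym Ux; have pA v := @G_pos x v Ux.
have lamA v := Hlam x v x1.
have LamA i j : G x i j <= Lam.
  by apply: le_trans (ler_norm _) _; exact: (HLam (i, j) x x2).
have pinch := pinching_all r12 sA pA Hk.
have s0 := scal_gt0 sA pA n3 lam0 del0 kap0 lamA pinch.
have rb := r_bound r12 r34 rB sA pA n3 lam0 Lam0 del0 kap0 lamA LamA pinch.
have CC2 : C2 * scal (rc x) <= (Sm + Dm + C2 + C3) * scal (rc x).
  by apply: ler_wpM2r; [exact: ltW | lra].
have CC3 : C3 * scal (rc x) <= (Sm + Dm + C2 + C3) * scal (rc x).
  by apply: ler_wpM2r; [exact: ltW | lra].
split => //.
- move=> u; exact: (einst_lower r12 r34 sA pA n3 lam0 Lam0 del0 kap0 lamA LamA pinch).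
- move=> i j; apply: le_trans CC2; rewrite /einst.
  apply: le_trans (ler_normB _ _) _; rewrite [leRHS](_ : _ = scal (rc x) + 2 * n%:R * C1 * scal (rc x)); last by rewrite /C2; ring.
  apply: lerD.
    by case: (j == i); rewrite ?mulr1 ?mulr0 ?normr0 ?gtr0_norm // ltW.
  rewrite [leRHS](_ : _ = 2 * (n%:R * (C1 * scal (rc x)))); last by ring.
  rewrite normrM gtr0_norm //; apply: ler_wpM2l => //.
  apply: le_trans (ler_norm_sum _ _ _) _.
  apply: (@le_trans _ _ (\sum_(k < n) C1 * scal (rc x))).
    by apply: ler_sum => k _; exact: rb.
  by rewrite sumr_const card_ord -[leLHS]mulr_natl.
- move=> j; apply: le_trans CC3.
  have cb i k a b : `|curv_low G i k x a b| <= C1 * scal (rc x).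
    by have := rb i k a b; rewrite /rc normrM sg1 mul1r.
  have sg1' : `|sg| <= 1 by rewrite sg1.
  have cn i a b : `|conn G i x a b| <= Gm by exact: (HGm (i, a, b) x x3).
  by have := div_einst_bound j Ux sg1' cn cb; rewrite /C3 !mulrA.
Qed.

Lemma no_boundary_chart q (l1 del : R) : U q -> 0 < l1 -> 0 < del ->
  box q l1 `<=` U ->
  (forall x, box q l1 x -> 0 < scal (rc x) -> pinched_at del x) ->
  (forall e, 0 < e -> exists2 x, `|q - x| < e & 0 < scal (rc x)) ->
  (forall e, 0 < e -> exists2 a, `|q - a| < e &
     exists2 rho : R, 0 < rho & forall x, `|a - x| < rho -> scal (rc x) <= 0) ->
  False.
Proof.
move=> Uq l10 del0 bU pin pos_near neg_near.
have nR : 0 < n%:R :> R by rewrite ltr0n (leq_trans _ n3).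
have nR1 : 1 <= n%:R :> R by rewrite ler1n (leq_trans _ n3).
have [d d0 [c [C [c0 C0 Hd]]]] := local_constants Uq del0.
(* The last entry keeps every coordinate of x - a at most 1 on the cube. *)
pose l := Num.min (l1 / 2) (Num.min (d / 2) (1 / 2)).
have l0 : 0 < l by rewrite !lt_min !divr_gt0.
have [ll1 ld l12] : [/\ l <= l1 / 2, l <= d / 2 & l <= 1 / 2].
  by split; rewrite /l !ge_min lexx ?orbT.
have bl x : box q l x -> [/\ box q l1 x, U x & `|q - x| < d].
  rewrite /box /= => xl; have b1 : box q l1 x by rewrite /box /=; lra.
  by split => //; [exact: bU | lra].
(* Points within [e] of [q] are at squared Euclidean distance at most l^2 / 16 from each other; n
   pays for passing from the sup norm to the Euclidean one. *)
pose e := l / (8 * n%:R).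
have n8 : 0 < 8 * n%:R :> R by rewrite mulr_gt0.
have e0 : 0 < e by rewrite divr_gt0.
have el : e <= l / 8.
  rewrite /e ler_pdivrMr //.
  have -> : l / 8 * (8 * n%:R) = l * n%:R by field.
  by rewrite ler_peMr // ltW.
have ne : n%:R * (2 * e * (2 * e)) <= l * l / 16.
  have -> : n%:R * (2 * e * (2 * e)) = l / 4 * (2 * e) by rewrite /e; field; rewrite gt_eqF.
  have -> : l * l / 16 = l / 4 * (2 * (l / 8)) by field.
  by apply: ler_wpM2l; [rewrite divr_ge0 // ltW | lra].
have [x1 qx1 sx1] := pos_near e e0.
have [a qa [rho rho0 Ha]] := neg_near e e0.
pose E := [set t | exists x, [/\ box q l x, 0 < scal (rc x) & t = dot (x - a) (x - a)]].
have Ex1 : E (dot (x1 - a) (x1 - a)).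
  by exists x1; split => //; rewrite /box /=; lra.
have dot_sup x : dot x x <= n%:R * (`|x| * `|x|).
  rewrite dotE; apply: (@le_trans _ _ (\sum_(i < n) `|x| * `|x|)).
    apply: ler_sum => i _; apply: le_trans (ler_norm _) _; rewrite normrM.
    by apply: ler_pM => //; exact: rV_norm_coord.
  by rewrite sumr_const card_ord -[leLHS]mulr_natl.
have sup_dot x t : 0 <= t -> dot x x <= t * t -> `|x| <= t.
  move=> t0 h; apply/(rV_norm_leP _ t0) => i.
  have h1 := coord_sq_le x i.
  rewrite -(@ler_pXn2r _ 2) ?nnegrE // (real_normK (num_real _)) expr2.
  by rewrite expr2 in h1; lra.
have Elb t : E t -> rho * rho <= t.
  move=> [x [bx sx ->]]; rewrite leNgt; apply/negP => lt.
  pose s := Num.sqrt (dot (x - a) (x - a)).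
  have s0 : 0 <= s by exact: sqrtr_ge0.
  have s2 : s * s = dot (x - a) (x - a) by rewrite -expr2 sqr_sqrtr // dot_ge0.
  have sr : s < rho by rewrite -(@ltr_pXn2r _ 2) ?nnegrE ?(ltW rho0) // !expr2 s2.
  have := Ha x; rewrite distrC => /(_ (le_lt_trans (sup_dot _ s s0 _) sr)).
  by rewrite s2 lexx => /(_ isT); lra.
have hlb : has_lbound E by exists (rho * rho) => t /Elb.
have hinf : has_inf E by split; [exists (dot (x1 - a) (x1 - a)) | exact: hlb].
pose r2 := inf E.
have r20 : 0 < r2.
  apply: (@lt_le_trans _ _ (rho * rho)); first by rewrite mulr_gt0.
  by apply: lb_le_inf => [|t /Elb //]; exists (dot (x1 - a) (x1 - a)).
have r2l : r2 <= l * l / 16.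
  apply: le_trans (ge_inf hlb Ex1) _; apply: le_trans (dot_sup _) _; apply: le_trans ne.
  apply: ler_wpM2l; first exact: ltW.
  have xa : `|x1 - a| <= 2 * e.
    have := ler_distD q x1 a; rewrite (distrC x1 q) => h; lra.
  by apply: ler_pM.
(* The first entry keeps the ball of squared radius r2 + tau <= l^2 / 8 about [a] off the faces; the
   last is the absorption condition. *)
pose tau := Num.min (l * l / 16) (Num.min 1 (c * r2 / (n%:R * C))).
have tau0 : 0 < tau by rewrite !lt_min ltr01 !divr_gt0 ?mulr_gt0.
have [t1 t2 t3] : [/\ tau <= l * l / 16, tau <= 1 & tau <= c * r2 / (n%:R * C)].
  by split; rewrite /tau !ge_min lexx ?orbT.
(* A near-minimizer of the distance to [a]: a point with S > 0 that lies inside the ball where the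
   cutoff is positive. *)
have [t [x2 [bx2 sx2 tE]] tlt] := inf_adherent tau0 hinf.
have x2a : `|x2 - a| <= l / 2.
  apply: sup_dot; first by rewrite divr_ge0 // ltW.
  rewrite -tE; move: tlt; rewrite -/r2 => tlt.
  have -> : l / 2 * (l / 2) = l * l / 4 by field.
  have := mulr_gt0 l0 l0; lra.
apply: (@divergence_contradiction R n U q a x2 l c C r2 tau (fun x => scal (rc x))
   (fun j i x => einst (rc x) j i)) => //.
- by move=> x /bl[].
- by rewrite -ler_pdivlMr // mulr_gt0.
- exact: Ck_scal.
- by move=> i j; exact: Ck_einst.
- move=> x u /bl[b1 Ux xd] sx; have [_ _ /(_ (pin x b1 sx))[_ H _ _]] := Hd x xd Ux.
  exact: H.
- move=> x i j /bl[b1 Ux xd] sx; have [_ _ /(_ (pin x b1 sx))[_ _ H _]] := Hd x xd Ux.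
  exact: H.
- move=> x j /bl[b1 Ux xd] sx; have [_ _ /(_ (pin x b1 sx))[_ _ _ H]] := Hd x xd Ux.
  exact: H.
- by move=> x /bl[b1 Ux xd]; have [] := Hd x xd Ux.
- by move=> i x /bl[b1 Ux xd]; have [_ H _] := Hd x xd Ux; exact: H.
- move=> x i bx; have := rV_norm_coord (x - a) i; rewrite !mxE.
  have := ler_distD q x a; rewrite (distrC x q); move: bx; rewrite /box /=; lra.
- by move=> x bx sx; apply: ge_inf => //; exists x.
- move=> i x bx qi.
  have h1 := ler_distD (a 0 i) (q 0 i) (x 0 i); rewrite qi (distrC (a 0 i)) in h1.
  have h2 := rV_norm_coord (q - a) i; rewrite !mxE in h2.
  have h3 : 3 / 4 * l <= `|x 0 i - a 0 i| by lra.
  have h4 := coord_sq_le (x - a) i; rewrite !mxE -(real_normK (num_real _)) in h4.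
  apply: le_trans h4; apply: (@le_trans _ _ ((3 / 4 * l) ^+ 2)).
    have -> : (3 / 4 * l) ^+ 2 = 9 / 16 * (l * l) by field.
    by have := mulr_gt0 l0 l0; lra.
  by rewrite lerXn2r // nnegrE ?mulr_ge0 ?(ltW l0) // ltW.
- by have := ler_distD a q x2; rewrite (distrC a x2); lra.
- by rewrite -tE.
Qed.

End Local.

Arguments rc {R n} G sg x i j k l.
Arguments pinched_at {R n} G sg del x.

(** * The manifold *)

(** Without such a point the closure of A would be open as well as closed. *)
Lemma connected_boundary (T : topologicalType) (A : set T) :
  connected [set: T] -> A !=set0 -> closure A != [set: T] ->
  exists2 p, closure A p & closure (~` closure A) p.
Proof.
move=> cT A0 nA; apply: contrapT => nex.
have oA : open (closure A).
  rewrite openE => p Ap; apply: contrapT => np; apply: nex; exists p => //.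
  by rewrite closure_setC.
move/eqP: nA; apply; apply: cT.
- by have [p Ap] := A0; exists p; exact: subset_closure.
- by exists (closure A) => //; rewrite setTI.
- by exists (closure A); [exact: closed_closure | rewrite setTI].
Qed.

Section Manifold.
Context {R : realType} {n : nat} {M : topologicalType}.
Context {S : smooth_structure R n M}.
Variable g : riemannian_metric S.
Hypothesis n3 : (3 <= n)%N.
Hypothesis tri : sectional_trichotomy g.
Variable sg : R.
Hypothesis sg1 : `|sg| = 1.

Definition signed_sec : set M := [set p | forall s : @tangent_plane R n M S p, 0 < sg * K_sec g s].

Lemma sg_cases : sg = 1 \/ sg = -1.
Proof.
move: sg1; have [s0|s0] := leP 0 sg; first by rewrite ger0_norm //; left.
by rewrite ltr0_norm // => h; right; rewrite -h opprK.
Qed.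

Lemma quad_K_sec p (s : @tangent_plane R n M S p) :
  quad (rc (g (plane_chart s)) sg (plane_chart s p)) (plane_u s) (plane_v s) /
    area (g (plane_chart s) (plane_chart s p)) (plane_u s) (plane_v s) =
  sg * K_sec g s.
Proof. by rewrite quad_rc /K_sec /sectional mulrA. Qed.

Section Chart.
Variable c : chart R n M.
Hypothesis cS : atlas S c.

Let U := c @` dom c.

Lemma chart_open : open U.
Proof. by have [] := atlas_chart cS. Qed.

Lemma chart_invK p : dom c p -> coord_inv c (c p) = p.
Proof. by have [_ _ H _ _] := atlas_chart cS; exact: H. Qed.

Lemma chart_smooth : smooth_on U (g c).
Proof. exact: Defs.metric_smooth. Qed.

Lemma chart_sym x : U x -> (g c x)^T = g c x.
Proof. exact: Defs.metric_sym. Qed.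

Lemma chart_pos x v : U x -> v != 0 -> 0 < inner (g c) x v v.
Proof. exact: Defs.metric_pos. Qed.

(** [kap] is the supremum of |K| at p. A positive [delta_sec] forces it to be finite and nonzero:
    the supremum of an unbounded set and the inverse of 0 both default to 0. *)
Lemma delta_pinched p (dK : R) : dom c p -> signed_sec p -> 0 < dK ->
  dK <= delta_sec g p -> pinched_at (g c) sg dK (c p).
Proof.
move=> cp Pp dK0; rewrite /delta_sec; set E := abs_K_values g p => dE.
have E0 t : E t -> 0 <= t by move=> [s _ <-].
have hlb : has_lbound E by exists 0 => t /E0.
have hsup : has_sup E.
  apply: contrapT => /sup_out sE; move: dE; rewrite sE invr0 mulr0.
  by rewrite leNgt dK0.
have sE0 : 0 < sup E.
  have [[t Et] _] := hsup.
  have : 0 <= sup E by apply: le_trans (E0 t Et) _; exact: sup_upper_bound.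
  rewrite le_eqVlt => /orP[/eqP sE|//]; move: dE; rewrite -sE invr0 mulr0.
  by rewrite leNgt dK0.
exists (sup E) => // u v uv.
pose s := TangentPlane cS cp uv.
have := quad_K_sec s; rewrite /= => ->.
have Es : E (sg * K_sec g s).
  by exists s => //; rewrite -[LHS]mul1r -sg1 -normrM gtr0_norm.
apply/andP; split; last exact: sup_upper_bound.
apply: le_trans (ge_inf hlb Es).
by rewrite -ler_pdivlMr.
Qed.

(** By the trichotomy every plane at such a point has negative signed curvature, or the point is
    flat. Hence {S > 0} lies in [signed_sec]. *)
Lemma scal_le0_outside p : dom c p -> ~ signed_sec p ->
  scal (rc (g c) sg (c p)) <= 0.
Proof.
move=> cp nP; apply: scal_le0; first exact: rc12.
have alt : (forall s : @tangent_plane R n M S p, sg * K_sec g s < 0) \/ flat_at g p.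
  have nP' : ~ forall s : @tangent_plane R n M S p, 0 < sg * K_sec g s by [].
  case: (tri p) => [[Hp _ _]|[_ Hn _]|[_ _ Hf]]; last by right.
  - case: sg_cases nP' => -> nP'; first by case: nP' => s; rewrite mul1r; exact: Hp.
    by left=> s; rewrite mulN1r oppr_lt0; exact: Hp.
  - case: sg_cases nP' => -> nP'; last by case: nP' => s; rewrite mulN1r oppr_gt0; exact: Hn.
    by left=> s; rewrite mul1r; exact: Hn.
move=> u v uv; case: alt => [neg|flat]; last by rewrite quad_rc (flat c cS cp) mulr0.
have Ux : U (c p) by exists p.
pose s := TangentPlane cS cp uv; have := neg s; rewrite -quad_K_sec /= => h.
have a0 : 0 <= area (g c (c p)) u v.
  by apply: area_ge0; [exact: chart_sym | move=> w; exact: chart_pos].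
by rewrite leNgt; apply/negP => q0; move: h; rewrite ltNge divr_ge0 // ltW.
Qed.

Lemma no_boundary p : dom c p -> locally_pinched_on g signed_sec ->
  closure signed_sec p -> closure (~` closure signed_sec) p -> False.
Proof.
move=> cp pin clP clN.
have [oD _ _ cc ci] := atlas_chart cS; have oU := chart_open.
have Uq : U (c p) by exists p.
have [l0 l00 bU] := open_normP oU Uq.
pose l := l0 / 2; have lpos : 0 < l by rewrite divr_gt0.
have boxU : box (c p) l `<=` U.
  by move=> x; rewrite /box /= => xl; apply: bU; apply: le_lt_trans xl _; rewrite /l; lra.
(* Pinching is assumed on compact subsets of M; this one gives a single constant for the whole
   cube. *)
have cK : compact (coord_inv c @` box (c p) l).
  apply: continuous_compact; last exact: box_compact.
  by apply: continuous_in_subspaceT => x; rewrite inE => /boxU Ux; exact: ci.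
have [dK dK0 HdK] := pin _ cK.
have pinU x : box (c p) l x -> signed_sec (coord_inv c x) -> pinched_at (g c) sg dK x.
  move=> bx Px; have [p' cp' xE] := boxU _ bx.
  rewrite -xE in bx Px *; rewrite chart_invK // in Px.
  apply: delta_pinched => //; apply: HdK; split => //.
  by exists (c p') => //; exact: chart_invK.
have scalP x : U x -> 0 < scal (rc (g c) sg x) -> signed_sec (coord_inv c x).
  move=> [p' cp' <-]; rewrite chart_invK // => s0; apply: contrapT => nP.
  by have := scal_le0_outside cp' nP; rewrite leNgt s0.
have near_p e : 0 < e -> nbhs p [set y | dom c y /\ `|c p - c y| < e].
  move=> e0; apply: filterI; first exact: open_nbhs_nbhs.
  have /cvgrPdist_lt := cc p cp; exact.
apply: (@no_boundary_chart R n U (g c) n3 oU chart_smooth chart_sym chart_pos sg sg1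
  (c p) l dK) => //.
- by move=> x bx sx; apply: pinU => //; apply: scalP => //; exact: boxU.
- move=> e e0.
  have m0 : 0 < Num.min e l by rewrite lt_min e0.
  have [y [Py [cy]]] := clP _ (near_p _ m0); rewrite lt_min => /andP[ye yl].
  exists (c y) => //.
  have by_ : box (c p) l (c y) by rewrite /box /= ltW.
  have Uy := boxU _ by_.
  have := pinU _ by_; rewrite chart_invK // => /(_ Py).
  (* At a point of [signed_sec] in the cube, pinching makes S strictly positive. *)
  move=> [kap kap0 Hk].
  have pA v := @chart_pos (c y) v Uy.
  have [lam lam0 lamA] := posdef_lower (leq_trans (isT : (0 < 3)%N) n3) pA.
  have sA := chart_sym Uy.
  have pinch := pinching_all (@rc12 R n (g c) sg (c y)) sA pA Hk.
  exact: (scal_gt0 sA pA n3 lam0 dK0 kap0 lamA pinch).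
- move=> e e0.
  have m0 : 0 < Num.min e l by rewrite lt_min e0.
  have [y [Ny [cy]]] := clN _ (near_p _ m0); rewrite lt_min => /andP[ye yl].
  exists (c y) => //.
  have Uy : U (c y) by exists y.
  have [r1 r10 Hr1] := open_normP oU Uy.
  have oN : open (~` closure signed_sec) by apply: closed_openC; exact: closed_closure.
  (* The complement of the closure is open, so in coordinates it contains a ball about [c y]; there
     S <= 0. *)
  have : nbhs (c y) [set x | (~` closure signed_sec) (coord_inv c x)].
    apply: (ci (c y) Uy); rewrite chart_invK //; exact: open_nbhs_nbhs.
  move=> /nbhs_normP[r2 r20 Hr2].
  exists (Num.min r1 r2); first by rewrite lt_min r10.
  move=> x; rewrite lt_min => /andP[/Hr1 Ux /Hr2 Nx].
  rewrite leNgt; apply/negP => sx; apply: Nx.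
  by apply: subset_closure; exact: scalP.
Qed.

End Chart.

Lemma signed_sec_dense : connected [set: M] -> locally_pinched_on g signed_sec ->
  signed_sec !=set0 -> closure signed_sec = [set: M].
Proof.
move=> cM pin P0; apply: contrapT => /eqP ne.
have [p p1 p2] := connected_boundary cM P0 ne.
have [c cS cp] := atlas_cover S p.
exact: (no_boundary cS cp pin p1 p2).
Qed.

(** The component of the curvature on one fixed coordinate plane is continuous in the chart, so its
    strict sign persists nearby; the nonnegative area does not affect the sign. *)
Lemma opposite_not_closure p : (forall s : @tangent_plane R n M S p, sg * K_sec g s < 0) ->
  ~ closure signed_sec p.
Proof.
move=> neg clP; have [c cS cp] := atlas_cover S p.
have [oD _ _ cc ci] := atlas_chart cS; have oU := chart_open cS.
pose i0 : 'I_n := Ordinal (leq_trans (isT : (0 < 3)%N) n3).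
pose i1 : 'I_n := Ordinal (leq_trans (isT : (1 < 3)%N) n3).
have free01 : row_free (col_mx (delta_mx 0 i0) (delta_mx 0 i1) : 'M[R]_(1 + 1, n)).
  exact: free_delta.
pose f x := rc (g c) sg x i0 i1 i1 i0.
have Uq : (c @` dom c) (c p) by exists p.
have fE y (cy : dom c y) : f (c y) / area (g c (c y)) (delta_mx 0 i0) (delta_mx 0 i1) =
    sg * K_sec g (TangentPlane cS cy free01).
  by rewrite -quad_K_sec /= quad_delta.
have a0 y : dom c y -> 0 <= area (g c (c y)) (delta_mx 0 i0) (delta_mx 0 i1).
  move=> cy; have Uy : (c @` dom c) (c y) by exists y.
  apply: area_ge0; first exact: chart_sym cS _ Uy.
  by move=> w; exact: chart_pos cS _ _ Uy.
have f0 : f (c p) < 0.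
  rewrite ltNge; apply/negP => f0; have := neg (TangentPlane cS cp free01).
  by rewrite -fE ltNge divr_ge0 // a0.
have cf : {for c p, continuous f}.
  by have := Ck_rc oU (chart_smooth cS) (@chart_pos _ cS) sg 0 i0 i1 i1 i0; apply.
have f0' : 0 < - f (c p) by rewrite oppr_gt0.
have [d d0 Hd] := continuous_normP cf f0'.
have : nbhs p [set y | dom c y /\ `|c p - c y| < d].
  apply: filterI; first exact: open_nbhs_nbhs.
  have /cvgrPdist_lt := cc p cp; exact.
move=> /clP[y [Py [cy /Hd]]]; rewrite ltr_norml => /andP[h1 h2].
have := Py (TangentPlane cS cy free01); rewrite -fE => h.
have fy : f (c y) < 0 by lra.
by move: h; rewrite ltNge mulr_le0_ge0 ?invr_ge0 ?a0 ?(ltW fy).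
Qed.

End Manifold.

(* From density of a sign class to the classification *)
Local Close Scope ring_scope.

Theorem theorem1p5 (R : realType) (n : nat) (hn : (3 <= n)%N)
    (M : topologicalType) (M_hausdorff : hausdorff_space M)
    (M_countable : @second_countable M)
    (M_connected : connected [set: M])
    (S : smooth_structure R n M) (g : riemannian_metric S)
    (trichotomy : sectional_trichotomy g) :
  [/\ locally_pinched_on g (nonflat g) ->
        exactly_one3
          (forall p, flat_at g p)
          [/\ N_sec g = set0, P_sec g !=set0 & interior (Z_sec g) = set0]
          [/\ P_sec g = set0, N_sec g !=set0 & interior (Z_sec g) = set0],
      locally_pinched_on g (P_sec g) ->
        P_sec g = set0 \/ (N_sec g = set0 /\ interior (Z_sec g) = set0) &
      locally_pinched_on g (N_sec g) ->
        N_sec g = set0 \/ (P_sec g = set0 /\ interior (Z_sec g) = set0)].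
Proof.
have PE : P_sec g = signed_sec g 1%R.
  by apply/seteqP; split => p Pp s; have := Pp s; rewrite mul1r.
have NE : N_sec g = signed_sec g (-1)%R.
  by apply/seteqP; split => p Pp s; have := Pp s; rewrite mulN1r oppr_gt0.
have n1 : `|1 : R|%R = 1%R by rewrite normr1.
have nN1 : `|-1 : R|%R = 1%R by rewrite normrN1.
have excl p : flat_at g p -> ~ pos_at g p /\ ~ neg_at g p.
  by case: (trichotomy p) => -[].
(* A dense set of nonflat points meets every neighborhood, so no point is interior to [Z_sec g]. *)
have dense_flat A : closure A = [set: M] -> (forall p, A p -> ~ flat_at g p) ->
    interior (Z_sec g) = set0.
  move=> dA Anf; apply/seteqP; split => // p Zp.
  have : closure A p by rewrite dA.
  by move=> /(_ _ Zp)[q [Aq]]; exact: Anf.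
have posP : locally_pinched_on g (P_sec g) ->
    P_sec g = set0 \/ (N_sec g = set0 /\ interior (Z_sec g) = set0).
  move=> pin; have [->|P0] := eqVneq (P_sec g) set0; first by left.
  right; have dP : closure (P_sec g) = [set: M].
    rewrite PE in pin P0 *; apply: (signed_sec_dense hn trichotomy n1) => //.
    exact/set0P.
  split; last by apply: dense_flat dP _ => p Pp /excl[].
  apply/seteqP; split => // p Np.
  (* Negative curvature persists near p, which contradicts the density of the positive points. *)
  have : ~ closure (signed_sec g 1%R) p.
    by apply: (opposite_not_closure hn) => // s; rewrite mul1r.
  by rewrite -PE dP; apply.
have posN : locally_pinched_on g (N_sec g) ->
    N_sec g = set0 \/ (P_sec g = set0 /\ interior (Z_sec g) = set0).
  move=> pin; have [->|N0] := eqVneq (N_sec g) set0; first by left.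
  right; have dN : closure (N_sec g) = [set: M].
    rewrite NE in pin N0 *; apply: (signed_sec_dense hn trichotomy nN1) => //.
    exact/set0P.
  split; last by apply: dense_flat dN _ => p Np /excl[].
  apply/seteqP; split => // p Pp.
  have : ~ closure (signed_sec g (-1)%R) p.
    by apply: (opposite_not_closure hn) => // s; rewrite mulN1r oppr_lt0.
  by rewrite -NE dN; apply.
split => // pin.
(* Pinching on the nonflat set restricts to both sign classes, so both one-sided statements become
   available. *)
have sub A : (forall p, A p -> ~ flat_at g p) -> locally_pinched_on g A.
  move=> Anf K cK; have [d d0 Hd] := pin K cK.
  by exists d => // p [Kp Ap]; apply: Hd; split => //; exact: Anf.
have pinP : locally_pinched_on g (P_sec g) by apply: sub => p Pp /excl[].
have pinN : locally_pinched_on g (N_sec g) by apply: sub => p Np /excl[].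
have nflat p : pos_at g p \/ neg_at g p -> ~ (forall p, flat_at g p).
  by move=> H F; have [nP nN] := excl p (F p); case: H.
have [P0|P0] := eqVneq (P_sec g) set0.
  have [N0|N0] := eqVneq (N_sec g) set0.
    constructor 1; split.
    - move=> p; case: (trichotomy p) => -[Hp Hn Hf] //.
        by have : P_sec g p by []; rewrite P0.
      by have : N_sec g p by []; rewrite N0.
    - by case=> _ [p]; rewrite P0.
    - by case=> _ [p]; rewrite N0.
  have /set0P[p Np] := N0.
  have [N0'|[_ Z0]] := posN pinN; first by rewrite N0' eqxx in N0.
  constructor 3; split; first by apply: (nflat p); right.
    by case=> _ [q]; rewrite P0.
  by split => //; exists p.
have /set0P[p Pp] := P0.
have [P0'|[N0 Z0]] := posP pinP; first by rewrite P0' eqxx in P0.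
constructor 2; split; first by apply: (nflat p); left.
  by split => //; exists p.
by case=> _ [q]; rewrite N0.
Qed.
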